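(* Let $n\ge3$ and let $\Theta:B_n\to\mathrm{Aut}(F_n)$ be a local $\mathrm{Aut}(F_n)$ representation of type $\mathcal{L}$, where $\mathcal{L}$ is one of $A_r$ with $r\ge1$, $C$, or $D$ (i.e. $\Theta$ is not of type $T$, $T'$, $A_0$, $B$). Then $\Theta$ is faithful.
   Context: $F_2$ is free on $a,b$; $F_n$ is free on $x_1,\dots,x_n$; $B_n$ has standard generators $\sigma_1,\dots,\sigma_{n-1}$ and acts on the right. For a word $W$ in $a^{\pm1},b^{\pm1}$, $W(U,V)$ denotes substitution of $U$ for $a$, $V$ for $b$. For $\tau\in\mathrm{Aut}(F_2)$ and $1\le i\le n-1$, $T^i(\tau)\in\mathrm{Aut}(F_n)$ fixes $x_j$ for $j\ne i,i+1$ and sends $x_i\mapsto \tau(a)(x_i,x_{i+1})$, $x_{i+1}\mapsto\tau(b)(x_i,x_{i+1})$. A local $\mathrm{Aut}(F_n)$ representation is a homomorphism $\Theta:B_n\to\mathrm{Aut}(F_n)$ such that $\Theta(\sigma_i)=T^i(\tau_i)$ for some $\tau_i\in\mathrm{Aut}(F_2)$ ($i=1,\dots,n-1$); we say $\Theta$ is defined by $(\tau_1,\dots,\tau_{n-1})$. Natural symmetries act on quadruples $(A,B,C,D)$ of reduced words with $\tau:a\mapsto A,b\mapsto B$, $\kappa:a\mapsto C,b\mapsto D$ automorphisms: Inverse replaces it by the reduced words of $\tau^{-1}(a),\tau^{-1}(b),\kappa^{-1}(a),\kappa^{-1}(b)$; Swap replaces it by $(D^{\sigma},C^{\sigma},B^{\sigma},A^{\sigma})$,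 $W^{\sigma}$ being $W$ with letters $a,b$ interchanged; Backward replaces it by the words read backwards $(\overleftarrow{A},\overleftarrow{B},\overleftarrow{C},\overleftarrow{D})$. Two quadruples are equivalent up to natural symmetries if related by a composition of these. Labelled list: ($A_r$-1) $(a^{r}ba^{-r},a,a^{r}ba^{-r},a)$; ($A_r$-2) $(a^{r}ba^{-r},a,a^{r}b^{-1}a^{-r},a^{-1})$; ($A_r$-3) $(a^{r}b^{-1}a^{-r},a^{-1},a^{-r}b^{-1}a^{r},a^{-1})$ ($r\in\mathbb{Z}_{\ge0}$); ($C$-1) $(ab^{-1}a,a,ab^{-1}a,a)$; ($C$-2) $(ab^{-1}a,a,aba,a^{-1})$; ($C$-3) $(aba,a^{-1},aba,a^{-1})$; ($D$-1) $(a^{-1}b^{-1}a,b^{2}a,a^{-1}b^{-1}a,b^{2}a)$; ($D$-2) $(aba^{-1},b^{2}a^{-1},a^{-1}b^{-1}a,b^{2}a)$; ($D$-3) $(a^{-1}b^{-1}a,b^{2}a,a^{-1}ba,a^{-1}b^{2})$; ($D$-4) $(aba^{-1},b^{2}a^{-1},a^{-1}ba,a^{-1}b^{2})$. The entries ($A_r$-1,2,3) with a fixed $r$ are labelled $A_r$, ($C$-1,2,3) labelled $C$, ($D$-1,…,4) labelled $D$. A local $\mathrm{Aut}(F_n)$ representation defined by $(\tau_1,\dots,\tau_{n-1})$ is of type $\mathcal{L}$ if for every $i=1,\dots,n-2$ the quadruple of reduced words $(\tau_i(a),\tau_i(b),\tau_{i+1}(a),\tau_{i+1}(b))$ is equivalent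 up to natural symmetries to an entry labelled $\mathcal{L}$. *)

(* Defs.v *)
From Stdlib Require Import Relations.Relation_Operators.
From Stdlib Require List.
From mathcomp Require Import all_boot.

Set Implicit Arguments.
Unset Strict Implicit.
Unset Printing Implicit Defensive.

(* A letter (k, false) is the generator x_k, (k, true) is x_k^{-1}.
   Generators of F_n are x_1, ..., x_n; for F_2, a = x_1 and b = x_2. *)
Definition letter := (nat * bool)%type.
Definition word := seq letter.

Definition inv_letter (l : letter) : letter := (l.1, ~~ l.2).

Definition cons_red (l : letter) (w : word) : word :=
  match w with
  | l' :: w' => if l' == inv_letter l then w' else l :: w
  | [::] => [:: l]
  end.

Definition red (w : word) : word := foldr cons_red [::] w.

Definition reduced (w : word) : Prop := red w = w.

Definition winv (w : word) : word := rev (map inv_letter w).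

Definition gen (k : nat) : word := [:: (k, false)].

Definition subst (f : nat -> word) (w : word) : word :=
  red (flatten (map (fun l : letter => if l.2 then winv (f l.1) else f l.1) w)).

Definition fun2 (U V : word) : nat -> word :=
  fun k => if k == 1 then U else if k == 2 then V else gen k.

Definition subst2 (W U V : word) : word := subst (fun2 U V) W.

Definition mutual_inverse2 (A B A' B' : word) : Prop :=
  [/\ subst2 A' A B = gen 1, subst2 B' A B = gen 2,
      subst2 A A' B' = gen 1 & subst2 B A' B' = gen 2].

Definition endo_eq (n : nat) (f g : nat -> word) : Prop :=
  forall j, 1 <= j <= n -> red (f j) = red (g j).

Definition Tmap (i : nat) (A B : word) : nat -> word :=
  fun j => if j == i then subst2 A (gen i) (gen i.+1)
           else if j == i.+1 then subst2 B (gen i) (gen i.+1)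
           else gen j.

(* A braid letter (i, false) is sigma_i, (i, true) is sigma_i^{-1}. *)
Definition braid_word := seq letter.

Definition braid_letters_ok (n : nat) (w : braid_word) : bool :=
  all (fun l : letter => (1 <= l.1) && (l.1 < n)) w.

Inductive braid_eq (n : nat) : braid_word -> braid_word -> Prop :=
| be_refl w : braid_eq n w w
| be_sym u v : braid_eq n u v -> braid_eq n v u
| be_trans u v w : braid_eq n u v -> braid_eq n v w -> braid_eq n u w
| be_ctx u v p s : braid_eq n u v -> braid_eq n (p ++ u ++ s) (p ++ v ++ s)
| be_free i e : 1 <= i -> i < n -> braid_eq n [:: (i, e); (i, ~~ e)] [::]
| be_comm i j : 1 <= i -> i.+1 < j -> j < n ->
    braid_eq n [:: (i, false); (j, false)] [:: (j, false); (i, false)]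
| be_braid i : 1 <= i -> i.+1 < n ->
    braid_eq n [:: (i, false); (i.+1, false); (i, false)]
               [:: (i.+1, false); (i, false); (i.+1, false)].

(* tau i = (tau_i(a), tau_i(b)); tauinv i = (tau_i^{-1}(a), tau_i^{-1}(b)). *)
Definition gen_img (tau tauinv : nat -> word * word) (l : letter) : nat -> word :=
  if l.2 then Tmap l.1 (tauinv l.1).1 (tauinv l.1).2
  else Tmap l.1 (tau l.1).1 (tau l.1).2.

(* Theta(w) as generator images; B_n acts on the right:
   x^(sigma w') = (x^sigma)^(w'). *)
Definition theta (tau tauinv : nat -> word * word) (w : braid_word) : nat -> word :=
  foldr (fun l g => fun j => subst g (gen_img tau tauinv l j)) gen w.

(* (tau_1, ..., tau_{n-1}) are automorphisms of F_2 (with inverses tauinv)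
   and the T^i(tau_i) satisfy the braid relations, i.e. sigma_i |-> T^i(tau_i)
   defines a homomorphism B_n -> Aut(F_n). *)
Definition local_rep (n : nat) (tau tauinv : nat -> word * word) : Prop :=
  (forall i, 1 <= i -> i < n ->
     mutual_inverse2 (tau i).1 (tau i).2 (tauinv i).1 (tauinv i).2) /\
  (forall i j, 1 <= i -> i.+1 < j -> j < n ->
     endo_eq n (theta tau tauinv [:: (i, false); (j, false)])
               (theta tau tauinv [:: (j, false); (i, false)])) /\
  (forall i, 1 <= i -> i.+1 < n ->
     endo_eq n (theta tau tauinv [:: (i, false); (i.+1, false); (i, false)])
               (theta tau tauinv [:: (i.+1, false); (i, false); (i.+1, false)])).

Definition faithful (n : nat) (tau tauinv : nat -> word * word) : Prop :=
  forall w1 w2 : braid_word,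
    braid_letters_ok n w1 -> braid_letters_ok n w2 ->
    endo_eq n (theta tau tauinv w1) (theta tau tauinv w2) ->
    braid_eq n w1 w2.

Record quad := Quad { qA : word; qB : word; qC : word; qD : word }.

Definition swap_letter (l : letter) : letter :=
  (if l.1 == 1 then 2 else if l.1 == 2 then 1 else l.1, l.2).
Definition swapw (w : word) : word := map swap_letter w.

Inductive sym_step : quad -> quad -> Prop :=
| sym_inverse A B C D A' B' C' D' :
    mutual_inverse2 A B A' B' -> mutual_inverse2 C D C' D' ->
    reduced A' -> reduced B' -> reduced C' -> reduced D' ->
    sym_step (Quad A B C D) (Quad A' B' C' D')
| sym_swap A B C D :
    sym_step (Quad A B C D) (Quad (swapw D) (swapw C) (swapw B) (swapw A))
| sym_backward A B C D :
    sym_step (Quad A B C D) (Quad (rev A) (rev B) (rev C) (rev D)).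

Definition sym_equiv (q q' : quad) : Prop := clos_refl_trans quad sym_step q q'.

Definition a_ : word := gen 1.
Definition b_ : word := gen 2.
Definition ai : word := winv a_.
Definition bi : word := winv b_.
Definition apow (r : nat) : word := nseq r (1, false).
Definition apowi (r : nat) : word := nseq r (1, true).

Inductive label := LA of nat | LC | LD.

Definition entries (L : label) : seq quad :=
  match L with
  | LA r =>
    [:: Quad (apow r ++ b_ ++ apowi r) a_ (apow r ++ b_ ++ apowi r) a_;
        Quad (apow r ++ b_ ++ apowi r) a_ (apow r ++ bi ++ apowi r) ai;
        Quad (apow r ++ bi ++ apowi r) ai (apowi r ++ bi ++ apow r) ai]
  | LC =>
    [:: Quad (a_ ++ bi ++ a_) a_ (a_ ++ bi ++ a_) a_;
        Quad (a_ ++ bi ++ a_) a_ (a_ ++ b_ ++ a_) ai;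
        Quad (a_ ++ b_ ++ a_) ai (a_ ++ b_ ++ a_) ai]
  | LD =>
    [:: Quad (ai ++ bi ++ a_) (b_ ++ b_ ++ a_) (ai ++ bi ++ a_) (b_ ++ b_ ++ a_);
        Quad (a_ ++ b_ ++ ai) (b_ ++ b_ ++ ai) (ai ++ bi ++ a_) (b_ ++ b_ ++ a_);
        Quad (ai ++ bi ++ a_) (b_ ++ b_ ++ a_) (ai ++ b_ ++ a_) (ai ++ b_ ++ b_);
        Quad (a_ ++ b_ ++ ai) (b_ ++ b_ ++ ai) (ai ++ b_ ++ a_) (ai ++ b_ ++ b_)]
  end.

Definition of_type (n : nat) (tau : nat -> word * word) (L : label) : Prop :=
  forall i, 1 <= i -> i <= n - 2 ->
    exists2 e, List.In e (entries L) &
      sym_equiv (Quad (red (tau i).1) (red (tau i).2)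
                      (red (tau i.+1).1) (red (tau i.+1).2)) e.

(* Main.v *)
(* Killing the squares of the generators maps F_n onto a free product W of
   copies of Z/2.  In types C and D every sign disappears there, and sigma_i acts
   by the Hurwitz move z_i -> z_i z_{i+1} z_i, z_{i+1} -> z_i.  In type A_r the
   same action governs the r-th powers x_i^r, once x_i is sent to an r-th root of
   z_i in a wreath product of W.  So it is enough that braids act faithfully on
   the n-tuples of reflections of W obtained from (z_1, ..., z_n).

   This is proved by peak reduction on the total length of the tuple.  A move
   shortens the tuple when one reflection branches off the first half of its
   neighbour.  Two distinct shortening moves are joined by a braid relation
   staying below the peak; the only configuration without such a relation, the
   two neighbours of x_i both passing through x_i, is excluded because the action
   preserves the cyclic order on the ends of the planar Cayley tree of W.  Hence
   all shortening sequences from a tuple to (z_1, ..., z_n) represent one braid,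
   which is the inverse of any braid producing the tuple. *)

Require Import Defs.
From HB Require Import structures.
From mathcomp Require Import all_boot zify.
From mathcomp Require Import ssralg zmodp.

Set Implicit Arguments.
Unset Strict Implicit.
Unset Printing Implicit Defensive.
Local Open Scope group_scope.

(** * The free product of copies of Z/2 *)

Definition zred (s : seq nat) : bool := sorted (fun x y => x != y) s.

Definition zcons (x : nat) (s : seq nat) : seq nat :=
  if s is y :: s' then if x == y then s' else x :: s else [:: x].

Lemma zred_zcons x s : zred s -> zred (zcons x s).
Proof.
case: s => //= y s; rewrite /zred /=.
by case: eqP => [_|/eqP xy] hs /=; [apply: path_sorted hs | rewrite xy].
Qed.

Lemma zconsK x s : zred s -> zcons x (zcons x s) = s.
Proof.
case: s => [|y s] /=; first by rewrite eqxx.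
case: (eqVneq x y) => [->|xy] /= hs; last by rewrite eqxx.
by case: s hs => [|t s] //=; rewrite /zred /=; case: eqP.
Qed.

Lemma zred_foldr u v : zred v -> zred (foldr zcons v u).
Proof. by move=> hv; elim: u => //= x u; exact: zred_zcons. Qed.

Lemma foldr_zcons x s w : zred s -> zred w ->
  foldr zcons w (zcons x s) = zcons x (foldr zcons w s).
Proof.
case: s => //= y s hs hw; case: eqP => [->|] //.
by rewrite zconsK // zred_foldr.
Qed.

(** A single [zcons] passes through by [foldr_zcons], a cancelling pair being absorbed by [zconsK];
    induction on [u] makes multiplication of normal forms associative. *)
Lemma foldr_zconsA u v w : zred v -> zred w ->
  foldr zcons w (foldr zcons v u) = foldr zcons (foldr zcons w v) u.
Proof.
by move=> hv hw; elim: u => //= x u <-; rewrite foldr_zcons // zred_foldr.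
Qed.

Lemma foldr_zcons_red u v : zred (u ++ v) -> foldr zcons v u = u ++ v.
Proof.
elim: u => //= x u IHu huv; rewrite IHu; last exact: path_sorted huv.
by case: (u ++ v) huv => //= y s; rewrite /zred /=; case: eqP.
Qed.

Lemma zred_rev s : zred (rev s) = zred s.
Proof.
rewrite /zred rev_sorted; congr (_ : bool).
by case: s => //= x s; apply: eq_path => a b /=; rewrite eq_sym.
Qed.

Lemma zred_nil : zred [::]. Proof. by []. Qed.

Definition zfree : Type := {s : seq nat | zred s}.
HB.instance Definition _ := Choice.on zfree.

Definition zmul (u v : zfree) : zfree :=
  exist _ (foldr zcons (val v) (val u)) (zred_foldr (val u) (valP v)).
Definition zone : zfree := exist _ [::] zred_nil.
Definition zinv (u : zfree) : zfree :=
  exist _ (rev (val u)) (etrans (zred_rev (val u)) (valP u)).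

Lemma zmulA : associative zmul.
Proof. by move=> u v w; apply: val_inj; rewrite /= foldr_zconsA ?valP. Qed.

Lemma zmul1 : left_id zone zmul.
Proof. by move=> u; apply: val_inj. Qed.

Lemma zmulr1 : right_id zone zmul.
Proof.
by move=> u; apply: val_inj; rewrite /= foldr_zcons_red cats0 // valP.
Qed.

Lemma foldr_zcons_rev s : zred s -> foldr zcons s (rev s) = [::].
Proof.
elim: s => //= x s IHs hs; rewrite rev_cons -cats1 foldr_cat /= eqxx.
by apply: IHs; apply: path_sorted hs.
Qed.

Lemma zmulV : left_inverse zone zinv zmul.
Proof. by move=> u; apply: val_inj; apply: foldr_zcons_rev; exact: valP. Qed.

Lemma zmulrV : right_inverse zone zinv zmul.
Proof.
move=> u; apply: val_inj => /=.
have := @foldr_zcons_rev (rev (val u)); rewrite revK; apply.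
by rewrite zred_rev; exact: valP.
Qed.

HB.instance Definition _ :=
  isGroup.Build zfree zmulA zmul1 zmulr1 zmulV zmulrV.

Definition zgen (x : nat) : zfree := exist _ [:: x] isT.

(* 0 for the empty word, x.+1 when the first letter is x. *)
Definition zhd (g : zfree) : nat := if val g is x :: _ then x.+1 else 0.
Arguments zhd : simpl never.
Definition zsize (g : zfree) : nat := size (val g).

Lemma zgenV x : (zgen x)^-1 = zgen x.
Proof. exact: val_inj. Qed.

Lemma zgen2 x : zgen x * zgen x = 1.
Proof. by rewrite -{1}zgenV mulVg. Qed.

Lemma zgenK x : involutive (fun g => zgen x * g).
Proof. by move=> g; rewrite mulgA zgen2 mul1g. Qed.

Lemma zhd_gen x : zhd (zgen x) = x.+1. Proof. by []. Qed.

Lemma zhd1 : zhd 1 = 0%N. Proof. by []. Qed.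

Lemma zhd_mulgen x g : zhd g <> x.+1 -> zhd (zgen x * g) = x.+1.
Proof.
rewrite /zhd /=; case: (val g) => //= y s hy.
by case: eqP => // xy; case: hy; rewrite xy.
Qed.

Lemma zhd_split g x : zhd g = x.+1 ->
  exists2 h, g = zgen x * h & zhd h <> x.+1.
Proof.
case: g => -[|y s] hs //= [yx]; subst y.
exists (exist _ s (path_sorted hs)); last first.
  by rewrite /zhd; case: s hs => //= y s; rewrite /zred /= => /andP[/eqP xy _] [yx]; case: xy.
apply: val_inj => /=; case: s hs => //= y s.
by rewrite /zred /=; case: eqP.
Qed.

Lemma zfree_ind (P : zfree -> Prop) :
  P 1 -> (forall x g, zhd g <> x.+1 -> P g -> P (zgen x * g)) -> forall g, P g.
Proof.
move=> P1 PS; case=> s; elim: s => [|x s IHs] hs.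
  by have -> : (exist _ [::] hs : zfree) = 1 by exact: val_inj.
have [h e hh] := @zhd_split (exist _ (x :: s) hs) x erefl.
rewrite e; apply: PS => //.
have eh : h = zgen x * exist _ (x :: s) hs by rewrite e zgenK.
have hs' : zred s by exact: path_sorted hs.
rewrite (_ : h = exist _ s hs'); first exact: IHs.
by rewrite eh; apply: val_inj; rewrite /= eqxx.
Qed.

Lemma val_mul_red (g h : zfree) :
  zred (val g ++ val h) -> val (g * h) = val g ++ val h.
Proof. exact: foldr_zcons_red. Qed.

(** * Universal property of the free product *)

Section Hom.
Variables (G : groupType) (f : nat -> G).

Definition zhom (g : zfree) : G := foldr (fun x h => f x * h) 1 (val g).

Hypothesis f2 : forall x, f x * f x = 1.

Lemma zhom_genl x g : zhom (zgen x * g) = f x * zhom g.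
Proof.
rewrite /zhom /=; case: (val g) => //= y s.
by case: eqP => //= ->; rewrite mulgA f2 mul1g.
Qed.

Lemma zhom1 : zhom 1 = 1. Proof. by []. Qed.

Lemma zhomM g h : zhom (g * h) = zhom g * zhom h.
Proof.
elim/zfree_ind: g => [|x g _ IHg]; first by rewrite !mul1g.
by rewrite -mulgA !zhom_genl IHg mulgA.
Qed.

Lemma zhom_gen x : zhom (zgen x) = f x.
Proof. by rewrite /zhom /= mulg1. Qed.

End Hom.

(** Uniqueness of the extension; that the values [f x] are involutions is forced by [k]. *)
Lemma zhom_morph (G : groupType) (f : nat -> G) (k : zfree -> G) :
  k 1 = 1 -> (forall g h, k (g * h) = k g * k h) ->
  (forall x, k (zgen x) = f x) -> zhom f =1 k.
Proof.
move=> k1 kM kf g.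
have f2 x : f x * f x = 1 by rewrite -!kf -kM zgen2 k1.
elim/zfree_ind: g => [|x g _ IH]; first by rewrite k1.
by rewrite zhom_genl // kM kf IH.
Qed.

(** * The cyclic order at infinity *)

(** Since inversion is reversal, [zhd g^-1] codes the last letter of [g], so the hypothesis says
    that nothing cancels at the junction. *)
Lemma zred_cat_zhd (g x : zfree) :
  zhd g^-1 <> zhd x -> zred (val g ++ val x).
Proof.
case: g x => [u hu] [v hv] /=.
rewrite /zhd /=; case: v hv => [|y v] hv; first by rewrite cats0.
case/lastP: u hu => [|u z] hu //; rewrite rev_rcons => zy.
have {}zy : z != y by apply/eqP=> e; apply: zy; rewrite e.
case: u hu => [|t u] hu; rewrite /zred /=; first by rewrite zy.
move: hu; rewrite /zred /= cat_path => -> /=.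
by rewrite last_rcons zy.
Qed.

Lemma zhd_mul (g x : zfree) :
  g <> 1 -> zhd g^-1 <> zhd x -> zhd (g * x) = zhd g.
Proof.
move=> g1 /zred_cat_zhd/val_mul_red; rewrite /zhd => ->.
case: g g1 => [[|y u] hu] //= g1; case: g1; exact: val_inj.
Qed.

Definition cyc (a b c : nat) : bool := [|| a < b < c, b < c < a | c < a < b]%N.

(* The cyclic order on the ends of the planar Cayley tree of [zfree]: the
   branches out of every vertex are ordered 0, 1, 2, ..., and the word itself
   (code 0) sits in the gap before the first branch.  [p] moves the branching
   point of the three words to the root. *)
Definition zcyc (u v w : zfree) : Prop :=
  exists p, cyc (zhd (p * u)) (zhd (p * v)) (zhd (p * w)).

Lemma zcyc_mull g u v w : zcyc u v w -> zcyc (g * u) (g * v) (g * w).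
Proof. by case=> p hp; exists (p * g^-1); rewrite -!mulgA !mulKg. Qed.

Lemma zcyc_rot u v w : zcyc u v w -> zcyc v w u.
Proof. by case=> p hp; exists p; move: hp; rewrite /cyc; lia. Qed.

(** The branching point is unique. Seen from another vertex [h^-1], all words outside the branch
    coded by [zhd h] have code [zhd h^-1]; of three words with distinct codes at the root, at least
    two then coincide there. *)
Lemma zcyc_asym u v w : zcyc u v w -> ~ zcyc v u w.
Proof.
case=> p + [q hq]; have [h he] : exists h, h = q * p^-1 by exists (q * p^-1).
have -> : p = h^-1 * q by rewrite he invgM invgK mulgVK.
move: hq; rewrite -!mulgA.
move: (q * u) (q * v) (q * w) => {}u {}v {}w {p q he}.
case: (eqVneq h^-1 1) => [->|/eqP h1].
  by rewrite !mul1g /cyc; lia.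
have hM x : zhd h = zhd x \/ zhd (h^-1 * x) = zhd h^-1.
  by case: (eqVneq (zhd h) (zhd x)) => [|/eqP hx];
    [left | right; apply: zhd_mul; rewrite ?invgK].
move: (hM u) (hM v) (hM w); rewrite /cyc.
move: (zhd h) (zhd u) (zhd v) (zhd w) (zhd h^-1) => a b c d e.
move: (zhd (h^-1 * u)) (zhd (h^-1 * v)) (zhd (h^-1 * w)) => b' c' d'.
lia.
Qed.

Lemma zcyc_neq u v w : zcyc u v w -> u <> v.
Proof. by case=> p + uv; rewrite uv /cyc; lia. Qed.

(** * Hurwitz moves and the cyclic order *)

Definition hurwitz (G : groupType) (a b : nat) (t : nat -> G) (j : nat) : G :=
  if j == a then t a * t b * t a else if j == b then t a else t j.

Lemma hurwitz_inv (G : groupType) a b (t : nat -> G) :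
  (forall j, t j * t j = 1) -> forall j, hurwitz a b t j * hurwitz a b t j = 1.
Proof.
move=> t2 j; rewrite /hurwitz; case: ifP => _; last case: ifP => _ //.
by rewrite -!mulgA (mulgA (t a) (t a)) t2 mul1g (mulgA (t b)) t2 mul1g t2.
Qed.

Section Phi.
Variables a b : nat.
Hypothesis ab : a != b.

Let t2 := hurwitz_inv a b zgen2.
Definition zphi : zfree -> zfree := zhom (hurwitz a b zgen).

Lemma zphiM g h : zphi (g * h) = zphi g * zphi h.
Proof. exact: zhomM. Qed.

(** When [u] begins with z_b, its first letter does not determine that of the image: the z_a
    replacing z_b cancels if z_a follows, which brings z_b to the front. The code after removal of
    z_a is recorded to carry the induction. *)
Lemma zhd_zphi u :
  if zhd u == a.+1 then
    zhd (zphi u) = a.+1 /\ zhd (zgen a * zphi u) = b.+1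
  else if zhd u == b.+1 then
    zhd (zphi u) = b.+1 \/ zhd (zphi u) = a.+1 /\
      zhd (zgen a * zphi u) <> a.+1 /\ zhd (zgen a * zphi u) <> b.+1
  else zhd (zphi u) = zhd u.
Proof.
elim/zfree_ind: u => [|x u xu IHu]; first by [].
rewrite zhd_mulgen //= !eqSS zphiM /zphi zhom_gen // -/(zphi u) /hurwitz.
have neq x' y : x' <> y -> x'.+1 <> y.+1 by lia.
case: (eqVneq x a) => [xa|/eqP xa]; last case: (eqVneq x b) => [xb|/eqP xb].
- subst x; rewrite -!mulgA zgenK.
  suff h : zhd (zgen b * (zgen a * zphi u)) = b.+1.
    by split=> //; rewrite zhd_mulgen ?h //; lia.
  move: IHu; case: eqP => // _; case: eqP => // _.
    case=> [e|[e [h1 h2]]]; apply: zhd_mulgen => //.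
    by rewrite zhd_mulgen ?e; lia.
  by move=> e; rewrite zhd_mulgen // zhd_mulgen ?e //; lia.
- subst x; move: IHu; case: eqP => [e [h1 h2]|ha]; first by left.
  by case: eqP => // hb e; right; rewrite zgenK zhd_mulgen e.
- rewrite /= zhd_mulgen //.
  move: IHu; case: eqP => [e [h1 h2]|_]; first by rewrite h1; lia.
  by case: eqP => [e [h1|[h1 _]]|_ ->] //; lia.
Qed.
End Phi.

(** Once the branching point is moved to the root, the image triple branches at the root or at z_a,
    the latter when words from the branches a and b both land behind z_a. The order survives because
    no code lies between those of the adjacent indices. *)
Lemma zcyc_zphi a b u v w : (a.+1 == b) || (b.+1 == a) ->
  zcyc u v w -> zcyc (zphi a b u) (zphi a b v) (zphi a b w).
Proof.
move=> hab [p hp]; have ab : a != b by lia.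
have t2 := hurwitz_inv a b zgen2.
suff H x y z : cyc (zhd x) (zhd y) (zhd z) ->
    zcyc (zphi a b x) (zphi a b y) (zphi a b z).
  have := zcyc_mull (zphi a b p)^-1 (H _ _ _ hp).
  by rewrite !zphiM // !mulKg.
have split4 x0 : [\/ [/\ zhd x0 = a.+1, zhd (zphi a b x0) = a.+1 &
                      zhd (zgen a * zphi a b x0) = b.+1],
    [/\ zhd x0 = b.+1, zhd (zphi a b x0) = b.+1 &
                      zhd (zgen a * zphi a b x0) = a.+1],
    [/\ zhd x0 = b.+1, zhd (zphi a b x0) = a.+1,
        zhd (zgen a * zphi a b x0) <> a.+1 &
        zhd (zgen a * zphi a b x0) <> b.+1] |
    [/\ zhd x0 <> a.+1, zhd x0 <> b.+1, zhd (zphi a b x0) = zhd x0 &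
        zhd (zgen a * zphi a b x0) = a.+1]].
  have := zhd_zphi ab x0; case: eqP => [? [? ?]|ha]; first by constructor 1.
  case: eqP => [hb [e|[? []]]|hb e]; last by constructor 4; rewrite // zhd_mulgen ?e.
    by constructor 2; rewrite // zhd_mulgen // e; lia.
  by constructor 3.
move=> H; suff : cyc (zhd (zphi a b x)) (zhd (zphi a b y)) (zhd (zphi a b z)) \/
    cyc (zhd (zgen a * zphi a b x)) (zhd (zgen a * zphi a b y))
        (zhd (zgen a * zphi a b z)).
  by case=> ?; [exists 1; rewrite !mul1g | exists (zgen a)].
move: (split4 x) (split4 y) (split4 z) H.
move: (zhd x) (zhd y) (zhd z) => i j k.
move: (zhd (zphi _ _ x)) (zhd (zphi _ _ y)) (zhd (zphi _ _ z)) => i1 j1 k1.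
move: (zhd (_ * zphi _ _ x)) (zhd (_ * zphi _ _ y)) (zhd (_ * zphi _ _ z)).
move=> i2 j2 k2 {split4 t2}; rewrite /cyc; case/orP: hab => /eqP ?; subst;
case=> h1; case=> h2; case=> h3 hc; destruct h1, h2, h3; subst; try lia.
Qed.

(** * Reflections and length *)

Arguments zsize g%_g.

Lemma zsizeV g : zsize g^-1 = zsize g.
Proof. by rewrite /zsize /= size_rev. Qed.

Lemma zsize_gen x : zsize (zgen x) = 1%N. Proof. by []. Qed.

Lemma zsizeM_le g h : (zsize (g * h) <= zsize g + zsize h)%N.
Proof.
rewrite /zsize /=; elim: (val g) => //= x s.
by case: (foldr _ _ _) => [|y t] /=; [lia | case: eqP => _ /=; lia].
Qed.

Lemma zsizeM g h : zhd g^-1 <> zhd h -> zsize (g * h) = (zsize g + zsize h)%N.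
Proof. by move=> /zred_cat_zhd/val_mul_red; rewrite /zsize => ->; rewrite size_cat. Qed.

Lemma zsize_gt0 g : (0 < zsize g)%N = (g != 1).
Proof. by rewrite -val_eqE /zsize /=; case: (val g). Qed.

Lemma zsize_mulgen x g : zhd g <> x.+1 -> zsize (zgen x * g) = (zsize g).+1.
Proof. by move=> h; rewrite zsizeM ?zgenV ?zhd_gen ?zsize_gen //; apply: nesym. Qed.

(** The half of the Cayley tree beyond the edge from [p] to [p * zgen a]. The recurring condition
    [zhd p^-1 <> a.+1] says that this half does not contain the root. *)
Definition zcone (p : zfree) (a : nat) (g : zfree) : Prop := zhd (p^-1 * g) = a.+1.

Section Cone.
Implicit Types (p q r : zfree) (a b c : nat).

Lemma zcone_split p a q : zhd p^-1 <> a.+1 -> zcone p a q ->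
  exists2 g, q = p * zgen a * g & zsize q = (zsize p + zsize g).+1.
Proof.
move=> pa /zhd_split[g e ga]; have eq : q = p * (zgen a * g) by rewrite -e mulVKg.
exists g; first by rewrite -mulgA.
by rewrite eq zsizeM ?zhd_mulgen // zsize_mulgen // addnS.
Qed.

Lemma zcone_last p a q : zhd p^-1 <> a.+1 -> zcone p a q ->
  zhd (p^-1 * q)^-1 = zhd q^-1.
Proof.
rewrite /zcone => pa e; have eq : q^-1 = (p^-1 * q)^-1 * p^-1 by rewrite -invgM mulVKg.
rewrite [in RHS]eq [RHS]zhd_mul //; last by rewrite invgK e; apply: nesym.
by move/eqP; rewrite invg_eq1 => /eqP k; rewrite k in e.
Qed.

Lemma zcone_mul p a q g : zhd p^-1 <> a.+1 -> zcone p a q ->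
  zhd q^-1 <> zhd g -> zcone p a (q * g).
Proof.
move=> pa paq qg; rewrite /zcone mulgA zhd_mul ?(zcone_last pa paq) //.
by move=> e; move: paq; rewrite /zcone e.
Qed.

Lemma zcone_trans p a q b r : zhd p^-1 <> a.+1 -> zhd q^-1 <> b.+1 ->
  zcone p a q -> zcone q b r -> zcone p a r.
Proof.
move=> pa qb paq; rewrite {1}/zcone => qbr; rewrite -(mulVKg q r).
by apply: zcone_mul; rewrite // qbr.
Qed.

(** Otherwise [p^-1 * r] is the product of [p^-1 * q] and [q^-1 * r] without cancellation, so it
    begins like [p^-1 * q], that is, not with z_a. *)
Lemma zcone_comparable p a q b r : zcone p a r -> zcone q b r ->
  [\/ p = q /\ a = b, zcone p a q | zcone q b p].
Proof.
rewrite /zcone; case: (eqVneq p q) => [<- -> [->]|pq hp hq]; first by constructor 1.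
case: (eqVneq (zhd (p^-1 * q)) a.+1) => [|/eqP ha]; first by constructor 2.
case: (eqVneq (zhd (q^-1 * p)) b.+1) => [|/eqP hb]; first by constructor 3.
case: ha; rewrite -hp -[in RHS](mulVKg q r) (mulgA p^-1) [RHS]zhd_mul //.
  by move/mulg1_eq; rewrite invgK => e; rewrite e eqxx in pq.
by rewrite invgM invgK hq.
Qed.
End Cone.

(** The second condition makes the palindrome reduced: [p] is the first half of the reflection [x]
    and [a] its middle letter. *)
Definition zrefl (x : zfree) (p : zfree) (a : nat) : Prop :=
  x = p * zgen a * p^-1 /\ zhd p^-1 <> a.+1.

Lemma zsize_conj_le s b : (zsize (s * zgen b * s^-1) <= (zsize s).*2.+1)%N.
Proof.
have := zsizeM_le (s * zgen b) s^-1; have := zsizeM_le s (zgen b).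
by rewrite zsizeV zsize_gen; lia.
Qed.

Lemma zsize_refl x p a : zrefl x p a -> zsize x = (zsize p).*2.+1.
Proof.
case=> -> pa; rewrite -mulgA zsizeM ?zhd_mulgen // zsize_mulgen // zsizeV.
by rewrite addnS addnn.
Qed.

Lemma conj_zrefl s b : exists p, zrefl (s * zgen b * s^-1) p b.
Proof.
case: (eqVneq (zhd s^-1) b.+1) => [|/eqP sb]; last by exists s.
case/zhd_split=> g e gb; exists g^-1; split; last by rewrite invgK.
by rewrite -{1}(invgK s) e !invgM zgenV invgK -!mulgA zgenK.
Qed.

Lemma zrefl_conj x p a s : zrefl x p a -> exists q, zrefl (s * x * s^-1) q a.
Proof.
case=> -> _; have [q hq] := conj_zrefl (s * p) a; exists q.
by rewrite invgM !mulgA in hq *.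
Qed.

Lemma zrefl2 x p a : zrefl x p a -> x * x = 1.
Proof. by case=> -> _; rewrite -!mulgA mulKg zgenK mulgV. Qed.

Lemma zrefl_inv x p a : zrefl x p a -> x^-1 = x.
Proof. by move/zrefl2/mulg1_eq. Qed.

Lemma zrefl_conjE x p a y q b : zrefl x p a -> zrefl y q b ->
  x * y * x = (x * q) * zgen b * (x * q)^-1.
Proof. by move=> hx [-> _]; rewrite invgM (zrefl_inv hx) !mulgA. Qed.

(** * Reflections shortening one another *)

Definition zdesc (x y : zfree) : bool := (zsize (x * y * x) < zsize y)%N.

Section Desc.
Variables (x p : zfree) (a : nat) (y q : zfree) (b : nat).
Hypotheses (hx : zrefl x p a) (hy : zrefl y q b).

(** The half [q] passes through the middle letter of [x], and multiplication by [x] deletes that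
    letter. *)
Lemma zcone_zdesc : zcone p a q -> zdesc x y.
Proof.
case: (hx) => ex pa /(zcone_split pa)[g eg sg].
rewrite /zdesc (zsize_refl hy) (zrefl_conjE hx hy).
have -> : x * q = p * g by rewrite ex eg -!mulgA mulKg zgenK.
by have := zsize_conj_le (p * g) b; have := zsizeM_le p g; lia.
Qed.

Lemma zsize_nzcone : x <> y -> ~ zcone p a q -> (zsize y < zsize (x * y * x))%N.
Proof.
case: (hx) => ex pa; case: (hy) => ey qb xy npaq.
rewrite (zsize_refl hy) (zrefl_conjE hx hy).
have [d ed] : exists d, d = p^-1 * q by eexists.
rewrite /zcone -ed in npaq.
have eq : q = p * d by rewrite ed mulVKg.
have es : x * q = p * (zgen a * d) by rewrite ex eq -!mulgA mulKg.
have ss : zsize (x * q) = (zsize p + zsize d).+1.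
  by rewrite es zsizeM ?zhd_mulgen // zsize_mulgen // addnS.
have sq : (zsize q <= zsize p + zsize d)%N by rewrite eq zsizeM_le.
(* Generically [x * q] is the half of the conjugate and is longer than [q]. If it ends in z_b, so
   does [d], which forces the length of [p] to be that of [q] plus that of [d]; even after loss of
   the last letter the half exceeds [q]. *)
case: (eqVneq (zhd (x * q)^-1) b.+1) => [sb|/eqP sb]; last first.
  by rewrite (@zsize_refl (x * q * zgen b * (x * q)^-1) (x * q) b) ?ss; [lia | split].
have d1 : d <> 1.
  move=> d1; move: sb; rewrite es d1 mulg1 invgM zgenV zhd_mulgen // => -[ab].
  by case: xy; rewrite ex ey eq d1 mulg1 ab.
have db : zhd d^-1 = b.+1.
  rewrite -sb es mulgA invgM zhd_mul //.
    by move/eqP; rewrite invg_eq1 => /eqP.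
  by rewrite invgK invgM zgenV zhd_mulgen.
have sp : zsize p = (zsize q + zsize d)%N.
  have -> : p = q * d^-1 by rewrite eq mulgK.
  by rewrite zsizeM ?zsizeV // db.
have [h eh hb] := zhd_split sb.
have es' : x * q = h^-1 * zgen b by rewrite -[LHS]invgK eh invgM zgenV.
have : zsize (x * q) = (zsize h).+1 by rewrite -zsizeV eh zsize_mulgen.
rewrite (@zsize_refl (x * q * zgen b * (x * q)^-1) h^-1 b); last first.
  by split; rewrite ?invgK // es' !invgM zgenV invgK -!mulgA zgenK.
have /eqP := d1; rewrite -zsize_gt0 zsizeV; lia.
Qed.

Lemma zdesc_zcone : x <> y -> zdesc x y -> zcone p a q.
Proof.
move=> xy; rewrite /zdesc => h; case: (eqVneq (zhd (p^-1 * q)) a.+1) => // /eqP k.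
by have := zsize_nzcone xy k; lia.
Qed.

Lemma zdesc_neq : zdesc x y -> x <> y.
Proof. by move=> + e; rewrite /zdesc e (zrefl2 hy) mul1g ltnn. Qed.

Lemma zdescP : zdesc x y -> zcone p a q.
Proof. by move=> h; exact: zdesc_zcone (zdesc_neq h) h. Qed.

(** This excludes plateaus: a move always changes the total length strictly. *)
Lemma zsize_conj_neq : x <> y -> zsize (x * y * x) <> zsize y.
Proof.
move=> xy; case: (eqVneq (zhd (p^-1 * q)) a.+1) => [/zcone_zdesc|/eqP k].
  by rewrite /zdesc; lia.
by have := zsize_nzcone xy k; lia.
Qed.
End Desc.

Definition isrefl x := exists p a, zrefl x p a.

Lemma zdesc_asym x y : isrefl x -> isrefl y -> zdesc x y -> ~~ zdesc y x.
Proof.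
case=> p [a hx] [q [b hy]] xy; apply/negP=> yx.
have [g _] := zcone_split hx.2 (zdescP hx hy xy).
have [h _] := zcone_split hy.2 (zdescP hy hx yx); lia.
Qed.

Lemma zdesc_trans x y z : isrefl x -> isrefl y -> isrefl z ->
  zdesc x y -> zdesc y z -> zdesc x z.
Proof.
case=> p [a hx] [q [b hy]] [r [c hz]] /(zdescP hx hy) xy /(zdescP hy hz) yz.
by apply: (zcone_zdesc hx hz); apply: zcone_trans xy yz; [case: hx | case: hy].
Qed.

(** The half of [z] is [p * zgen a * g * zgen b * h]; the two conjugations delete both middle
    letters. *)
Lemma zdesc_conj2 x y z : isrefl x -> isrefl y -> isrefl z ->
  zdesc x y -> zdesc y z -> (zsize (x * (y * z * y) * x) < zsize z)%N.
Proof.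
case=> p [a hx] [q [b hy]] [r [c hz]] /(zdescP hx hy) xy /(zdescP hy hz) yz.
have [g eg sg] := zcone_split hx.2 xy; have [h eh sh] := zcone_split hy.2 yz.
have -> : x * (y * z * y) * x = (x * y * r) * zgen c * (x * y * r)^-1.
  by rewrite hz.1 !invgM (zrefl_inv hx) (zrefl_inv hy) !mulgA.
have -> : x * y * r = p * (g * h).
  by rewrite eh hy.1 -!mulgA mulKg zgenK hx.1 eg -!mulgA mulKg zgenK.
rewrite (zsize_refl hz); have := zsize_conj_le (p * (g * h)) c.
by have := zsizeM_le p (g * h); have := zsizeM_le g h; lia.
Qed.

(** Two half-trees containing the half of [y] are nested. *)
Lemma zdesc_comparable x y z : isrefl x -> isrefl y -> isrefl z -> x <> z ->
  zdesc x y -> zdesc z y -> zdesc x z \/ zdesc z x.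
Proof.
case=> p [a hx] [q [b hy]] [r [c hz]] xz /(zdescP hx hy) xy /(zdescP hz hy) zy.
case: (zcone_comparable xy zy) => [[pr ac]|pr|rp].
- by case: xz; rewrite hx.1 hz.1 pr ac.
- by left; apply: (zcone_zdesc hx hz).
- by right; apply: (zcone_zdesc hz hx).
Qed.

(* Seen from outside the branch b, the words x and z sit in the same direction. *)
Lemma zcyc_branch b n1 n2 x z : zhd n1 = b.+1 -> zhd n2 = b.+1 ->
  zhd x <> b.+1 -> zhd z <> b.+1 -> zcyc n1 x n2 -> zcyc n1 z n2.
Proof.
move=> h1 h2 hx hz [s hs]; exists s; move: hs.
case: (eqVneq s 1) => [->|/eqP s1]; first by rewrite !mul1g h1 h2 /cyc; lia.
case: (eqVneq (zhd s^-1) b.+1) => [sb|/eqP sb].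
  by rewrite (zhd_mul s1 (x := x)) ?(zhd_mul s1 (x := z)) // sb; apply: nesym.
by rewrite (zhd_mul s1 (x := n1)) ?(zhd_mul s1 (x := n2)) ?h1 ?h2 // /cyc; lia.
Qed.

(** The words [x] and [z] lie beyond the edge fixed by [y], whereas [1] and [y * z] lie on the near
    side. Hence [x] may be replaced by [z] in the first cyclic triple, contradicting the second. *)
Lemma zdesc_zcyc x y z : isrefl x -> isrefl y -> isrefl z ->
  zdesc y x -> zdesc y z -> zcyc 1 x (y * z) -> zcyc 1 (y * z) z -> False.
Proof.
case=> q [a hx] [p [b hy]] [r [c hz]].
move=> /(zdescP hy hx) pbq /(zdescP hy hz) pbr.
have cone_refl w s d : zrefl w s d -> zcone p b s -> zcone p b w.
  case=> -> sd ps; rewrite -mulgA; apply: zcone_mul ps _; first by case: hy.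
  by rewrite zhd_mulgen.
have [x' ex hx'] := zhd_split (cone_refl _ _ _ hx pbq).
have [z' ez hz'] := zhd_split (cone_refl _ _ _ hz pbr).
have eyz : p^-1 * (y * z) = z'.
  by rewrite -[z](mulVKg p) ez hy.1 -!mulgA !mulKg zgenK.
move=> /(zcyc_mull (zgen b * p^-1)) + /(zcyc_mull (zgen b * p^-1)).
rewrite -!mulgA !mulg1 ex ez !zgenK eyz => c1 c2.
have hn1 : zhd (zgen b * p^-1) = b.+1 by rewrite zhd_mulgen //; case: hy.
have := zcyc_branch hn1 (zhd_mulgen hz') hx' hz' c1.
by move/zcyc_rot; apply/zcyc_asym/zcyc_rot/zcyc_rot/zcyc_rot/zcyc_rot.
Qed.

(** * Hurwitz moves *)

(** Taking the pair of positions in either order lets [hurwitz] serve both a generator and its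
    inverse. *)
Definition lfst (l : letter) : nat := if l.2 then l.1.+1 else l.1.
Definition lsnd (l : letter) : nat := if l.2 then l.1 else l.1.+1.

Definition hact (w : braid_word) : nat -> zfree :=
  foldr (fun l t => hurwitz (lfst l) (lsnd l) t) zgen w.

Lemma hact_refl w j : isrefl (hact w j).
Proof.
elim: w j => [|l w IHw] j /=.
  by exists 1, j; split; rewrite // mul1g invg1 mulg1.
rewrite /hurwitz; case: ifP => _; last by case: ifP.
have [p [a ha]] := IHw (lfst l); have [q [b hb]] := IHw (lsnd l).
rewrite -{2}(zrefl_inv ha); have [r hr] := zrefl_conj (hact w (lfst l)) hb.
by exists r, b.
Qed.

Lemma hact2 w j : hact w j * hact w j = 1.
Proof. by have [p [a /zrefl2]] := hact_refl w j. Qed.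

Lemma hactK w j g : hact w j * (hact w j * g) = g.
Proof. by rewrite mulgA hact2 mul1g. Qed.

Lemma hurwitz_eq a b (t t' : nat -> zfree) :
  t =1 t' -> hurwitz a b t =1 hurwitz a b t'.
Proof. by move=> tt j; rewrite /hurwitz !tt. Qed.

Lemma hact_cat_eq p w w' : hact w =1 hact w' -> hact (p ++ w) =1 hact (p ++ w').
Proof. by move=> ww; elim: p => //= l p IHp; apply: hurwitz_eq. Qed.

(** Prepending a letter is a move on the tuple, but as an endomorphism it is precomposition with
    [zphi]. This transfers the invariance of the cyclic order to [hact]. *)
Lemma zhom_hact_cons l w g :
  zhom (hact (l :: w)) g = zhom (hact w) (zphi (lfst l) (lsnd l) g).
Proof.
pose k g := zhom (hact w) (zphi (lfst l) (lsnd l) g).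
apply: (zhom_morph (k := k)) g => [|g1 g2|x]; rewrite /k {k}; first by rewrite /zphi !zhom1.
  by rewrite zphiM zhomM //; exact: hact2.
rewrite /zphi zhom_gen /hurwitz.
rewrite (fun_if (zhom _)) (fun_if (zhom _)) !zhomM ?zhom_gen //; exact: hact2.
Qed.

Lemma zhom_zgen g : zhom zgen g = g.
Proof. by apply: (@zhom_morph _ zgen (fun h => h) _ _ _ g). Qed.

Lemma zcyc_hact w u v x : zcyc u v x ->
  zcyc (zhom (hact w) u) (zhom (hact w) v) (zhom (hact w) x).
Proof.
elim: w u v x => [|l w IHw] u v x; first by rewrite !zhom_zgen.
rewrite !zhom_hact_cons => h; apply/IHw/zcyc_zphi => //.
by rewrite /lfst /lsnd; case: l.2; rewrite eqxx ?orbT.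
Qed.

(** Injectivity comes from the cyclic order: [1], z_i and z_j are in order, hence so are their
    images. *)
Lemma hact_inj w i j : i <> j -> hact w i <> hact w j.
Proof.
wlog : i j / (i < j)%N.
  move=> H ij; case: (ltnP i j) => ij'; first exact: H.
  by apply/nesym/H; lia.
move=> ij _.
have : zcyc 1 (zgen i) (zgen j) by exists 1; rewrite !mul1g !zhd_gen zhd1 /cyc; lia.
move=> /(zcyc_hact w)/zcyc_rot/zcyc_neq.
by rewrite !zhom_gen //; exact: hact2.
Qed.

(** The triples (1, z_i, z_{i+1} z_{i+2}) and (1, z_{i+1} z_{i+2}, z_{i+2}) are in cyclic order at
    the root; their images contradict the two shortenings. *)
Lemma hact_valley w i :
  zdesc (hact w i.+1) (hact w i) -> zdesc (hact w i.+1) (hact w i.+2) -> False.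
Proof.
move=> h1 h2; apply: (zdesc_zcyc _ _ _ h1 h2); try exact: hact_refl.
  have : zcyc 1 (zgen i) (zgen i.+1 * zgen i.+2).
    by exists 1; rewrite !mul1g zhd_mulgen !zhd_gen ?zhd1 /cyc; lia.
  by move/(zcyc_hact w); rewrite !zhomM ?zhom_gen //; exact: hact2.
have : zcyc 1 (zgen i.+1 * zgen i.+2) (zgen i.+2).
  by exists 1; rewrite !mul1g zhd_mulgen !zhd_gen ?zhd1 /cyc; lia.
by move/(zcyc_hact w); rewrite !zhomM ?zhom_gen //; exact: hact2.
Qed.

(** * Calculus of braid words *)

Definition letter_ok (n : nat) (l : letter) : bool := (1 <= l.1)%N && (l.1 < n)%N.

Section Braid.
Variable n : nat.
Local Notation "u ~~ v" := (braid_eq n u v) (at level 70).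
Implicit Types (u v w p d s : braid_word) (l : letter).

Lemma be_catl p u v : u ~~ v -> p ++ u ~~ p ++ v.
Proof. by move=> h; have := be_ctx p [::] h; rewrite !cats0. Qed.

Lemma be_catr s u v : u ~~ v -> u ++ s ~~ v ++ s.
Proof. exact: (be_ctx [::] s). Qed.

Lemma be_linv l : letter_ok n l -> [:: inv_letter l; l] ~~ [::].
Proof.
case: l => i e /andP[h1 h2]; have := be_free (~~ e) h1 h2.
by rewrite /inv_letter /= negbK.
Qed.

Lemma be_rinv l : letter_ok n l -> [:: l; inv_letter l] ~~ [::].
Proof. by case: l => i e /andP[h1 h2]; exact: be_free. Qed.

Lemma be_cancell d u v : all (letter_ok n) d -> d ++ u ~~ d ++ v -> u ~~ v.
Proof.
elim: d u v => //= l d IHd u v /andP[hl hd] h; apply: IHd hd _.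
have H x : x ~~ [:: inv_letter l] ++ l :: x.
  by apply: be_sym; apply: (be_catr x (be_linv hl)).
exact: be_trans (H _) (be_trans (be_catl _ h) (be_sym (H _))).
Qed.

Lemma be_cancelr d u v : all (letter_ok n) d -> u ++ d ~~ v ++ d -> u ~~ v.
Proof.
elim/last_ind: d u v => [|d l IHd] u v; first by rewrite !cats0.
rewrite all_rcons -cats1 => /andP[hl hd] h; apply: IHd hd _.
have H x : x ~~ (x ++ [:: l]) ++ [:: inv_letter l].
  rewrite -catA -{1}[x]cats0; apply: be_catl; exact: be_sym (be_rinv hl).
apply: be_trans (H _) (be_trans _ (be_sym (H _))).
by apply: be_catr; rewrite -!catA.
Qed.

Lemma be_invert1 l u v : letter_ok n l -> l :: u ~~ v -> u ~~ inv_letter l :: v.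
Proof.
move=> hl h; apply: (@be_cancell [:: l]); first by rewrite /= hl.
apply: be_trans h _; apply: be_sym; exact: (be_catr v (be_rinv hl)).
Qed.

Lemma be_inverts1 l u v : letter_ok n l -> rcons u l ~~ v ->
  u ~~ rcons v (inv_letter l).
Proof.
move=> hl h; apply: (@be_cancelr [:: l]); first by rewrite /= hl.
rewrite cats1; apply: be_trans h _; apply: be_sym; rewrite -cats1 -catA -{2}[v]cats0.
exact: (be_catl v (be_linv hl)).
Qed.

Lemma be_comm_inv l1 l2 : letter_ok n l1 ->
  [:: l1; l2] ~~ [:: l2; l1] -> [:: inv_letter l1; l2] ~~ [:: l2; inv_letter l1].
Proof.
move=> ok1 h; apply: (be_inverts1 (v := [:: l2]) ok1); apply: be_sym.
exact: (be_invert1 (u := [:: l2]) ok1).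
Qed.

Lemma be_comm_sign i j e f : (1 <= i)%N -> (i.+1 < j)%N -> (j < n)%N ->
  [:: (i, e); (j, f)] ~~ [:: (j, f); (i, e)].
Proof.
move=> h1 h2 h3; have h0 := be_comm h1 h2 h3.
have ok k : (1 <= k)%N -> (k < n)%N -> letter_ok n (k, false).
  by rewrite /letter_ok => -> ->.
have {}h0 : [:: (i, e); (j, false)] ~~ [:: (j, false); (i, e)].
  by case: e => //; apply: be_comm_inv h0; apply: ok; lia.
case: f => //; apply/be_sym/(be_comm_inv _ (be_sym h0)); apply: ok; lia.
Qed.

Lemma be_winvl u : all (letter_ok n) u -> winv u ++ u ~~ [::].
Proof.
elim: u => [|l u IHu] /=; first by move=> _; apply: be_refl.
case/andP=> hl hu; rewrite /winv /= rev_cons -cats1 -catA.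
apply: be_trans (IHu hu); apply: be_catl.
by apply: (be_catr u (be_linv hl)).
Qed.

Lemma winvK u : winv (winv u) = u.
Proof.
rewrite /winv map_rev revK -map_comp -[RHS]map_id; apply: eq_map.
by case=> i e; rewrite /= /inv_letter /= negbK.
Qed.

Lemma letter_ok_winv u : all (letter_ok n) (winv u) = all (letter_ok n) u.
Proof. by rewrite /winv all_rev all_map; apply: eq_all => -[]. Qed.

Lemma be_winvr u : all (letter_ok n) u -> u ++ winv u ~~ [::].
Proof.
by move=> hu; rewrite -{1}(winvK u); apply: be_winvl; rewrite letter_ok_winv.
Qed.

Lemma be_winv u v : all (letter_ok n) u -> all (letter_ok n) v ->
  u ~~ v -> winv u ~~ winv v.
Proof.
move=> hu hv uv; apply: (@be_cancell u) => //.
apply: be_trans (be_winvr hu) (be_sym _).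
exact: be_trans (be_catr _ uv) (be_winvr hv).
Qed.

(** For neighbours [i], [j] this is the letter acting as [hurwitz i j]. Together with [consec] it
    treats increasing and decreasing runs of positions alike. *)
Definition move_letter (i j : nat) : letter :=
  if (i < j)%N then (i, false) else (j, true).

Definition consec (i j k : nat) : bool :=
  (j == i.+1) && (k == j.+1) || (i == j.+1) && (j == k.+1).

Lemma be_braid_move i j k : consec i j k ->
  (0 < i <= n)%N -> (0 < j <= n)%N -> (0 < k <= n)%N ->
  [:: move_letter i j; move_letter j k; move_letter i j] ~~
  [:: move_letter j k; move_letter i j; move_letter j k].
Proof.
rewrite /consec /move_letter => /orP[] /andP[/eqP e1 /eqP e2] hi hj hk; subst.
  by rewrite !ltnS !leqnn; apply: be_braid; lia.
rewrite !ltnNge !leqnSn /=; apply: be_sym.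
apply: (@be_winv [:: (k, false); (k.+1, false); (k, false)]
                 [:: (k.+1, false); (k, false); (k.+1, false)]).
- by rewrite /letter_ok /=; lia.
- by rewrite /letter_ok /=; lia.
- by apply: be_braid; lia.
Qed.

Lemma move_letter_ok i j : (j == i.+1) || (i == j.+1) ->
  (0 < i <= n)%N -> (0 < j <= n)%N -> letter_ok n (move_letter i j).
Proof. by move=> ij hi hj; rewrite /letter_ok /move_letter; case: (ltnP i j) => h /=; lia. Qed.

Lemma move_letterV i j : (j == i.+1) || (i == j.+1) ->
  move_letter j i = inv_letter (move_letter i j).
Proof.
by move=> ij; rewrite /move_letter; case: (ltnP i j); case: (ltnP j i) => // h1 h2; lia.
Qed.

(** The braid relation with its outer letters carried across; this is the form that joins two moves
    onto the same middle position. *)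
Lemma be_braid_conj i j k : consec i j k ->
  (0 < i <= n)%N -> (0 < j <= n)%N -> (0 < k <= n)%N ->
  [:: move_letter j i; move_letter j k; move_letter i j] ~~
  [:: move_letter j k; move_letter i j; move_letter k j].
Proof.
move=> c hi hj hk; have h := be_braid_move c hi hj hk.
have ij : (j == i.+1) || (i == j.+1) by move: c; rewrite /consec; lia.
have jk : (k == j.+1) || (j == k.+1) by move: c; rewrite /consec; lia.
rewrite (move_letterV ij) (move_letterV jk).
have okA := move_letter_ok ij hi hj; have okB := move_letter_ok jk hj hk.
apply: (be_inverts1 (v := [:: _; _]) okB); apply: be_sym.
exact: (be_invert1 okA h).
Qed.

Lemma hact_move i j w : (j == i.+1) || (i == j.+1) ->
  hact (move_letter i j :: w) =1 hurwitz i j (hact w).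
Proof.
move=> ij x /=; rewrite /move_letter /lfst /lsnd.
by case: (ltnP i j) => h /=; congr (hurwitz _ _ _ _); lia.
Qed.

Lemma hurwitz_fst (t : nat -> zfree) i j : hurwitz i j t i = t i * t j * t i.
Proof. by rewrite /hurwitz eqxx. Qed.

Lemma hurwitz_snd (t : nat -> zfree) i j : i <> j -> hurwitz i j t j = t i.
Proof. by rewrite /hurwitz eqxx; case: eqP => [->|]. Qed.

Lemma hurwitz_oth (t : nat -> zfree) i j k : k <> i -> k <> j ->
  hurwitz i j t k = t k.
Proof. by rewrite /hurwitz => /eqP/negbTE -> /eqP/negbTE ->. Qed.

Lemma hurwitzK i j (t : nat -> zfree) : (forall x, t x * t x = 1) -> i <> j ->
  hurwitz i j (hurwitz j i t) =1 t.
Proof.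
move=> t2 ij k; have tK x g : t x * (t x * g) = g by rewrite mulgA t2 mul1g.
case: (eqVneq k i) => [->|/eqP ki].
  rewrite hurwitz_fst hurwitz_fst hurwitz_snd; last exact: nesym.
  by rewrite -!mulgA !tK t2 mulg1.
case: (eqVneq k j) => [->|/eqP kj].
  by rewrite hurwitz_snd // hurwitz_snd //; exact: nesym.
by rewrite !hurwitz_oth.
Qed.

Lemma hurwitz_comm i j i' j' (t : nat -> zfree) :
  i <> i' -> i <> j' -> j <> i' -> j <> j' ->
  hurwitz i j (hurwitz i' j' t) =1 hurwitz i' j' (hurwitz i j t).
Proof.
move=> h1 h2 h3 h4 k; rewrite /hurwitz.
have e1 := introF eqP h1; have e2 := introF eqP h2.
have e3 := introF eqP h3; have e4 := introF eqP h4.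
rewrite !e1 !e2 !e3 !e4 ![i' == _]eq_sym ![j' == _]eq_sym !e1 !e2 !e3 !e4.
case: (eqVneq k i) => [->|_]; first by rewrite e1 e2.
by case: (eqVneq k j) => [->|_] //; rewrite e3 e4.
Qed.

Lemma hurwitz_braid i j k (t : nat -> zfree) : (forall x, t x * t x = 1) ->
  i <> j -> j <> k -> i <> k ->
  hurwitz i j (hurwitz j k (hurwitz i j t)) =1
  hurwitz j k (hurwitz i j (hurwitz j k t)).
Proof.
move=> t2 ij jk ik x; have tK y g : t y * (t y * g) = g by rewrite mulgA t2 mul1g.
have [[ji kj] ki] := (nesym ij, nesym jk, nesym ik).
case: (eqVneq x i) => [->|/eqP xi].
  rewrite !(hurwitz_fst, hurwitz_oth _ ij ik, hurwitz_oth _ ki kj, hurwitz_snd) //.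
  by rewrite -!mulgA !tK.
case: (eqVneq x j) => [->|/eqP xj].
  by rewrite !(hurwitz_fst, hurwitz_oth _ ij ik, hurwitz_oth _ ki kj, hurwitz_snd).
case: (eqVneq x k) => [->|/eqP xk].
  by rewrite !(hurwitz_fst, hurwitz_oth _ ij ik, hurwitz_oth _ ki kj, hurwitz_snd).
by rewrite !hurwitz_oth.
Qed.

Lemma hact_braid_eq u v w : u ~~ v -> hact (u ++ w) =1 hact (v ++ w).
Proof.
move=> uv; elim: uv w => {u v} //=.
- by move=> u v _ IH w x; rewrite IH.
- by move=> u v z _ IH1 _ IH2 w x; rewrite IH1 IH2.
- by move=> u v p s _ IH w; rewrite -!catA; apply: hact_cat_eq; exact: IH.
- move=> i e _ _ w; rewrite /lfst /lsnd; case: e => /=; apply: hurwitzK (@hact2 w) _; lia.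
- by move=> i j _ ij _ w; rewrite /lfst /lsnd /=; apply: hurwitz_comm; lia.
- by move=> i _ _ w; rewrite /lfst /lsnd /=; apply: hurwitz_braid (@hact2 w) _ _ _; lia.
Qed.

Lemma hact_letterK l w : letter_ok n l -> hact (inv_letter l :: l :: w) =1 hact w.
Proof. by move=> /be_linv/(@hact_braid_eq _ _ w). Qed.

(** Position 0 is moved by no valid letter and only contributes the constant 1. *)
Definition hsize (w : braid_word) : nat := \sum_(j < n.+1) zsize (hact w j).

Lemma hsize_eq w w' : hact w =1 hact w' -> hsize w = hsize w'.
Proof. by move=> h; apply: eq_bigr => j _; rewrite h. Qed.

(** The multiset of entries changes only in the replacement of [hact w j] by its conjugate; the
    additive form avoids truncated subtraction. *)
Lemma hsize_move i j w : (j == i.+1) || (i == j.+1) -> (i <= n)%N -> (j <= n)%N ->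
  (hsize (move_letter i j :: w) + zsize (hact w j) =
   hsize w + zsize (hact w i * hact w j * hact w i))%N.
Proof.
move=> ij; rewrite -ltnS => hi; rewrite -ltnS => hj; rewrite /hsize.
have neq : Ordinal hj != Ordinal hi by rewrite -val_eqE /=; lia.
rewrite (eq_bigr (fun x : 'I_n.+1 => zsize (hurwitz i j (hact w) x))); last first.
  by move=> x _; rewrite hact_move.
rewrite (bigD1 (Ordinal hi)) //= (bigD1 (Ordinal hj)) //=.
rewrite [in RHS](bigD1 (Ordinal hi)) //= [in RHS](bigD1 (Ordinal hj)) //=.
rewrite hurwitz_fst hurwitz_snd; last by lia.
rewrite (eq_bigr (fun x : 'I_n.+1 => zsize (hact w x))); first lia.
move=> x; rewrite -!val_eqE /= => /andP[xi xj].
by rewrite hurwitz_oth //; apply/eqP.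
Qed.

Lemma hsize_lt i j w : (j == i.+1) || (i == j.+1) -> (i <= n)%N -> (j <= n)%N ->
  (hsize (move_letter i j :: w) < hsize w)%N = zdesc (hact w i) (hact w j).
Proof.
by move=> ij hi hj; have := hsize_move w ij hi hj; rewrite /zdesc; lia.
Qed.

Lemma hsize_neq i j w : (j == i.+1) || (i == j.+1) -> (i <= n)%N -> (j <= n)%N ->
  hsize (move_letter i j :: w) <> hsize w.
Proof.
move=> ij hi hj; have := hsize_move w ij hi hj.
have [p [a hx]] := hact_refl w i; have [q [b hy]] := hact_refl w j.
have := zsize_conj_neq hx hy; have : hact w i <> hact w j by apply: hact_inj; lia.
by move=> h /(_ h); lia.
Qed.

(** Both ends of the path are included; the letters of [p] are applied from the last to the
    first. *)
Fixpoint below (N : nat) (p w : braid_word) : bool :=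
  (hsize (p ++ w) < N)%N && (if p is _ :: p' then below N p' w else true).

Arguments hact : simpl never.

(** * Diamonds over a braid relation *)

Section Diamond.
Variables (i j k : nat) (w : braid_word).
Hypotheses (c : consec i j k).
Hypotheses (hi : (0 < i <= n)%N) (hj : (0 < j <= n)%N) (hk : (0 < k <= n)%N).
Local Notation x := (hact w i).
Local Notation y := (hact w j).
Local Notation z := (hact w k).

Let ij : (j == i.+1) || (i == j.+1). Proof. by move: c; rewrite /consec; lia. Qed.
Let ji : (i == j.+1) || (j == i.+1). Proof. by move: c; rewrite /consec; lia. Qed.
Let jk : (k == j.+1) || (j == k.+1). Proof. by move: c; rewrite /consec; lia. Qed.
Let kj : (j == k.+1) || (k == j.+1). Proof. by move: c; rewrite /consec; lia. Qed.
Let nij : i <> j. Proof. by move: ij; lia. Qed.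
Let njk : j <> k. Proof. by move: jk; lia. Qed.
Let nik : i <> k. Proof. by move: c; rewrite /consec; lia. Qed.
Let leij (a : nat) : (0 < a <= n)%N -> (a <= n)%N. Proof. by case/andP. Qed.

Let nji := nesym nij.
Let nkj := nesym njk.
Let nki := nesym nik.

Lemma hact_ij : [/\ hact (move_letter i j :: w) i = x * y * x,
  hact (move_letter i j :: w) j = x & hact (move_letter i j :: w) k = z].
Proof. by split; rewrite hact_move // ?hurwitz_fst ?hurwitz_snd ?hurwitz_oth. Qed.

Lemma hact_jk_ij : [/\ hact (move_letter j k :: move_letter i j :: w) i = x * y * x,
  hact (move_letter j k :: move_letter i j :: w) j = x * z * x &
  hact (move_letter j k :: move_letter i j :: w) k = x].
Proof.
have [e1 e2 e3] := hact_ij.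
split; rewrite hact_move //.
- by rewrite hurwitz_oth.
- by rewrite hurwitz_fst e2 e3.
- by rewrite hurwitz_snd.
Qed.

(** By transitivity [x] also shortens [z], and so does conjugation by [y] followed by [x]. The
    tuples on the hexagon carry these shorter conjugates, and the sixth size follows from the braid
    relation. *)
Lemma below_chain : zdesc x y -> zdesc y z ->
  below (hsize w) [:: move_letter i j; move_letter j k] (move_letter i j :: w) &&
  below (hsize w) [:: move_letter j k; move_letter i j] (move_letter j k :: w).
Proof.
move=> xy yz; have rx := hact_refl w i; have ry := hact_refl w j.
have rz := hact_refl w k; have xz := zdesc_trans rx ry rz xy yz.
have xyz := zdesc_conj2 rx ry rz xy yz; move: xy yz xz; rewrite /zdesc => xy yz xz.
have e1 := hsize_move w ij (leij hi) (leij hj).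
have e2 := hsize_move (move_letter i j :: w) jk (leij hj) (leij hk).
have e3 := hsize_move (move_letter j k :: move_letter i j :: w) ij (leij hi) (leij hj).
have e4 := hsize_move w jk (leij hj) (leij hk).
have e5 := hsize_move (move_letter j k :: w) ij (leij hi) (leij hj).
have e6 := hsize_eq (hact_braid_eq w (be_braid_move c hi hj hk)).
have [v1 v2 v3] := hact_ij; have [v4 v5 v6] := hact_jk_ij.
have v7 : hact (move_letter j k :: w) i = x by rewrite hact_move // hurwitz_oth.
have v8 : hact (move_letter j k :: w) j = y * z * y by rewrite hact_move // hurwitz_fst.
rewrite v2 v3 in e2; rewrite v7 v8 in e5; rewrite v4 v5 in e3.
have e : x * y * x * (x * z * x) * (x * y * x) = x * (y * z * y) * x.
  by rewrite -!mulgA !hactK.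
rewrite e in e3; rewrite /= in e6; rewrite /below /=.
lia.
Qed.

(** The same computation with [y] innermost: [x] shortens [y] and [z], and conjugating [y] by [z]
    and then by [x] shortens it. *)
Lemma below_fork : zdesc x z -> zdesc z y ->
  below (hsize w) [:: move_letter j i; move_letter j k] (move_letter i j :: w) &&
  below (hsize w) [:: move_letter j k; move_letter i j] (move_letter k j :: w).
Proof.
move=> xz zy; have rx := hact_refl w i; have ry := hact_refl w j.
have rz := hact_refl w k; have xy := zdesc_trans rx rz ry xz zy.
have xzy := zdesc_conj2 rx rz ry xz zy; move: xy zy xz; rewrite /zdesc => xy zy xz.
have e1 := hsize_move w ij (leij hi) (leij hj).
have e2 := hsize_move (move_letter i j :: w) jk (leij hj) (leij hk).
have e3 := hsize_move (move_letter j k :: move_letter i j :: w) ji (leij hj) (leij hi).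
have e4 := hsize_move w kj (leij hk) (leij hj).
have e5 := hsize_move (move_letter k j :: w) ij (leij hi) (leij hj).
have e6 := hsize_eq (hact_braid_eq w (be_braid_conj c hi hj hk)).
have [v1 v2 v3] := hact_ij; have [v4 v5 v6] := hact_jk_ij.
have v7 : hact (move_letter k j :: w) i = x by rewrite hact_move // hurwitz_oth.
have v8 : hact (move_letter k j :: w) j = z by rewrite hact_move // hurwitz_snd.
rewrite v2 v3 in e2; rewrite v7 v8 in e5; rewrite v4 v5 in e3.
have e : x * z * x * (x * y * x) * (x * z * x) = x * (z * y * z) * x.
  by rewrite -!mulgA !hactK.
rewrite e in e3; rewrite /= in e6; rewrite /below /=.
lia.
Qed.
End Diamond.
End Braid.

(** * Peak reduction *)

Section Peak.
Variable n : nat.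
Local Notation "u ~~ v" := (braid_eq n u v) (at level 70).
Local Notation hsize := (hsize n).
Implicit Types (u v w p d s : braid_word) (l : letter).

Lemma move_letterE l : l = move_letter (lfst l) (lsnd l).
Proof.
by case: l => i [] /=; rewrite /lfst /lsnd /move_letter /=; case: ltnP => // h; lia.
Qed.

Lemma lfst_lsnd l : letter_ok n l ->
  [/\ (lsnd l == (lfst l).+1) || (lfst l == (lsnd l).+1),
      (0 < lfst l <= n)%N & (0 < lsnd l <= n)%N].
Proof. by case: l => i [] /andP[/= h1 h2]; split; rewrite /lfst /lsnd /=; lia. Qed.

Lemma hsize_lt_letter l w : letter_ok n l ->
  (hsize (l :: w) < hsize w)%N = zdesc (hact w (lfst l)) (hact w (lsnd l)).
Proof.
move=> /lfst_lsnd[h /andP[_ h1] /andP[_ h2]].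
by rewrite {1}(move_letterE l) hsize_lt.
Qed.

Definition diamond w l1 l2 := exists p1 p2,
  [/\ all (letter_ok n) p1 /\ all (letter_ok n) p2, p1 ++ [:: l1] ~~ p2 ++ [:: l2],
      below n (hsize w) p1 (l1 :: w) & below n (hsize w) p2 (l2 :: w)].

Lemma diamond_sym w l1 l2 : diamond w l1 l2 -> diamond w l2 l1.
Proof.
by case=> p1 [p2 [[h1 h2] h3 h4 h5]]; exists p2, p1; split=> //; exact: be_sym.
Qed.

Lemma diamond_chain w i j k : consec i j k ->
  (0 < i <= n)%N -> (0 < j <= n)%N -> (0 < k <= n)%N ->
  zdesc (hact w i) (hact w j) -> zdesc (hact w j) (hact w k) ->
  diamond w (move_letter i j) (move_letter j k).
Proof.
move=> c hi hj hk xy yz.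
have okA : letter_ok n (move_letter i j).
  by apply: move_letter_ok => //; move: c; rewrite /consec; lia.
have okB : letter_ok n (move_letter j k).
  by apply: move_letter_ok => //; move: c; rewrite /consec; lia.
have /andP[b1 b2] := below_chain c hi hj hk xy yz.
exists [:: move_letter i j; move_letter j k], [:: move_letter j k; move_letter i j].
by split=> //=; rewrite ?okA ?okB //; apply: be_braid_move.
Qed.

Lemma diamond_fork w i j k : consec i j k ->
  (0 < i <= n)%N -> (0 < j <= n)%N -> (0 < k <= n)%N ->
  zdesc (hact w i) (hact w k) -> zdesc (hact w k) (hact w j) ->
  diamond w (move_letter i j) (move_letter k j).
Proof.
move=> c hi hj hk xz zy.
have okA : letter_ok n (move_letter i j).
  by apply: move_letter_ok => //; move: c; rewrite /consec; lia.
have okA' : letter_ok n (move_letter j i).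
  by apply: move_letter_ok => //; move: c; rewrite /consec; lia.
have okB : letter_ok n (move_letter j k).
  by apply: move_letter_ok => //; move: c; rewrite /consec; lia.
have /andP[b1 b2] := below_fork c hi hj hk xz zy.
exists [:: move_letter j i; move_letter j k], [:: move_letter j k; move_letter i j].
by split=> //=; rewrite ?okA ?okA' ?okB //; apply: be_braid_conj.
Qed.

Lemma diamondP w l1 l2 : letter_ok n l1 -> letter_ok n l2 -> l1 <> l2 ->
  (hsize (l1 :: w) < hsize w)%N -> (hsize (l2 :: w) < hsize w)%N ->
  diamond w l1 l2.
Proof.
wlog : l1 l2 / (l1.1 <= l2.1)%N.
  move=> H ok1 ok2 l12 h1 h2; case: (leqP l1.1 l2.1) => h; first exact: H.
  by apply: diamond_sym; apply: H => //; [lia | exact: nesym].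
move=> le12 ok1 ok2 l12 h1 h2.
(* Distant letters commute, and neither affects the entries used by the other, so both stay
   shortening. *)
case: (ltnP l1.1.+1 l2.1) => [far|near].
  have comm : [:: l1; l2] ~~ [:: l2; l1].
    case: l1 l2 ok1 ok2 far {le12 l12 h1 h2} => i e [j f] /andP[/= ? ?] /andP[/= ? ?] far.
    exact: be_comm_sign.
  exists [:: l2], [:: l1]; split.
  - by rewrite /= ok1 ok2.
  - exact: be_sym.
  - rewrite /below /= h1 !andbT; apply: (ltn_trans _ h1).
    rewrite hsize_lt_letter // /hact /= !hurwitz_oth -?hsize_lt_letter //;
      by move: far; rewrite /lfst /lsnd; case: l1.2; case: l2.2; lia.
  - rewrite /below /= h2 !andbT; apply: (ltn_trans _ h2).
    rewrite hsize_lt_letter // /hact /= !hurwitz_oth -?hsize_lt_letter //;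
      by move: far; rewrite /lfst /lsnd; case: l1.2; case: l2.2; lia.
move: h1 h2; rewrite !hsize_lt_letter //.
case: l1 l2 le12 ok1 ok2 l12 near => i e [j f] /= le12 ok1 ok2 l12 near.
rewrite [X in diamond _ X _]move_letterE [X in diamond _ _ X]move_letterE /lfst /lsnd /=.
(* Opposite signs on the same pair would make two reflections shorten each other. *)
case: (eqVneq i j) l12 => [<-|ij] l12.
  case: e f ok1 ok2 l12 => [] [] _ _ l12 h1 h2; try (by case: l12);
  by have := zdesc_asym (hact_refl _ _) (hact_refl _ _) h1; rewrite h2.
have {ij le12 near} ej : j = i.+1 by lia.
move: ok1 ok2; rewrite ej /letter_ok /= => /andP[a1 a2] a3.
have c1 : consec i i.+1 i.+2 by rewrite /consec; lia.
have c2 : consec i.+2 i.+1 i by rewrite /consec; lia.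
(* In order: a decreasing chain; the middle entry shortening both neighbours, which is excluded;
   both neighbours shortening the middle one, where nesting tells which of them shortens the other;
   an increasing chain. *)
case: e f {l12} => [] [] /= h1 h2.
- by apply: diamond_sym; apply: diamond_chain h2 h1; rewrite //; lia.
- by case: (hact_valley h1 h2).
- have nxz : hact w i <> hact w i.+2 by apply: hact_inj; lia.
  have := zdesc_comparable (hact_refl _ _) (hact_refl _ _) (hact_refl _ _) nxz h1 h2.
  case=> h; first by apply: diamond_fork h h2; rewrite //; lia.
  by apply: diamond_sym; apply: diamond_fork h h1; rewrite //; lia.
- by apply: diamond_chain h1 h2; rewrite //; lia.
Qed.

(* The letters of d are multiplied to w from the last one to the first. *)
Inductive descent : braid_word -> braid_word -> Prop :=
| Descent0 w : hact w =1 zgen -> descent w [::]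
| DescentS w d l : letter_ok n l -> (hsize (l :: w) < hsize w)%N ->
    descent (l :: w) d -> descent w (rcons d l).

Lemma descent_eq w w' d : hact w =1 hact w' -> descent w d -> descent w' d.
Proof.
move=> ww' h; elim: h w' ww' => {w d} [w e|w d l ok lt _ IH] w' ww'.
  by apply: Descent0 => j; rewrite -ww'.
have e : hact (l :: w) =1 hact (l :: w') by apply: (hact_cat_eq [:: l]).
by apply: DescentS (IH _ e); rewrite // -(hsize_eq n e) -(hsize_eq n ww').
Qed.

Lemma descent_ok w d : descent w d -> all (letter_ok n) d.
Proof. by elim=> // {}w {}d l ok _ _; rewrite all_rcons ok. Qed.

Lemma hsize_ge w : (n.+1 <= hsize w)%N.
Proof.
rewrite -[n.+1]card_ord -sum1_card; apply: leq_sum => j _.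
by have [p [a /zsize_refl ->]] := hact_refl w j.
Qed.

Lemma hsize_std w : hact w =1 zgen -> hsize w = n.+1.
Proof.
by move=> e; rewrite /hsize (eq_bigr (fun=> 1%N)) ?sum1_card ?card_ord // => j _; rewrite e.
Qed.

(** Independence of the first step, up to braid equality. The letter [l] may also lengthen, in which
    case [rcons d' l] is no descent. *)
Definition step_ok v l := forall d, descent v d ->
  exists2 d', descent (l :: v) d' & rcons d' l ~~ d.

Definition unique_descent v := forall d1 d2, descent v d1 -> descent v d2 -> d1 ~~ d2.

Definition down_ok v := forall l, letter_ok n l -> (hsize (l :: v) < hsize v)%N -> step_ok v l.

(** A lengthening letter is undone by a shortening one, which is put in front of the given descent;
    equal length is impossible. *)
Lemma step_ok_gen v l : letter_ok n l -> down_ok v -> down_ok (l :: v) -> step_ok v l.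
Proof.
move=> ok dv dlv; have [lt|gt|eq] := ltngtP (hsize (l :: v)) (hsize v).
- exact: dv.
- move=> d hd; exists (rcons d (inv_letter l)).
    apply: DescentS; first by case: l ok {dlv gt} => i e.
      by rewrite (hsize_eq n (hact_letterK v ok)).
    by apply: descent_eq hd => j; rewrite (hact_letterK v ok).
  rewrite -!cats1 -catA -[X in _ ~~ X]cats0; apply: be_catl; exact: be_linv.
- case/lfst_lsnd: ok => h /andP[_ h1] /andP[_ h2].
  by case: (hsize_neq h h1 h2 (w := v)); rewrite -move_letterE.
Qed.

Lemma letter_ok_inv l : letter_ok n (inv_letter l) = letter_ok n l.
Proof. by case: l. Qed.

Section Below.
Variable N : nat.
Hypothesis IH : forall v, (hsize v < N)%N -> down_ok v.

Lemma below_cat p v : below n N p v -> (hsize (p ++ v) < N)%N.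
Proof. by case: p => [|l p] /andP[]. Qed.

(** Transports a descent from the start of a path below [N] to its end; [path_ascent] goes back by
    inverse letters. *)
Lemma path_descent p v d : all (letter_ok n) p -> below n N p v -> descent v d ->
  exists2 d', descent (p ++ v) d' & d' ++ p ~~ d.
Proof.
elim: p => [|l p IHp] /= => [_ _|/andP[ok hp] /andP[lt hb]] hd.
  by exists d; rewrite ?cats0 //; exact: be_refl.
have [d1 h1 e1] := IHp hp hb hd.
have [d2 h2 e2] := step_ok_gen ok (IH (below_cat hb)) (IH lt) h1.
exists d2 => //; apply: be_trans e1; rewrite -cat_rcons; exact: be_catr.
Qed.

Lemma path_ascent p v d : all (letter_ok n) p -> below n N p v -> descent (p ++ v) d ->
  exists2 d', descent v d' & d' ~~ d ++ p.
Proof.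
elim: p d => [|l p IHp] d /= => [_ _|/andP[ok hp] /andP[lt hb]] hd.
  by exists d; rewrite ?cats0 //; exact: be_refl.
have oki : letter_ok n (inv_letter l) by rewrite letter_ok_inv.
have eK := hact_letterK (p ++ v) ok.
have lt' : (hsize (inv_letter l :: l :: p ++ v) < N)%N.
  by rewrite (hsize_eq n eK); exact: below_cat hb.
have [d1 h1 e1] := step_ok_gen oki (IH lt) (IH lt') hd.
have [d2 h2 e2] := IHp _ hp hb (descent_eq eK h1).
exists d2 => //; apply: be_trans e2 _; rewrite -cat_rcons; apply: be_catr.
have -> : l = inv_letter (inv_letter l) by case: (l) => i e; rewrite /inv_letter /= negbK.
exact: be_inverts1.
Qed.
End Below.

(** Both claims are proved together by strong induction on the total length, in the manner of local
    confluence implying confluence. *)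
Lemma unique_down v : unique_descent v /\ down_ok v.
Proof.
move: {2}(hsize v).+1 (ltnSn (hsize v)) => N; elim: N v => // N IHN v; rewrite ltnS => leN.
have IH u : (hsize u < hsize v)%N -> unique_descent u /\ down_ok u.
  by move=> lt; apply: IHN; exact: leq_trans lt leN.
suff dv : down_ok v.
  split=> // d1 d2 h1 h2.
  case: h1 dv IH h2 => {v leN d1} [v e _ _|v d1 l ok lt h1] h2.
    case: h2 e => {v d2} [*|v d l ok lt _ e]; first exact: be_refl.
    (* The standard tuple has the least total length, so no letter shortens it. *)
    by have := hsize_ge (l :: v); rewrite (hsize_std e) in lt; lia.
  move=> IH h3; have [d3 h4 h5] := h2 _ ok lt _ h3.
  apply: be_trans h5; rewrite -!cats1; apply: be_catr.
  exact: (IH _ lt).1.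
move=> l ok lt d hd.
case: hd ok lt IH => {v leN d} [v e|v d l0 ok0 lt0 hd] ok lt IH.
  by have := hsize_ge (l :: v); rewrite (hsize_std e) in lt; lia.
case: (eqVneq l l0) => [e|/eqP ll0]; first by exists d; rewrite e //; exact: be_refl.
have IH' u : (hsize u < hsize v)%N -> down_ok u by case/IH.
(* The descent through [l0] is pushed along [p0] to the bottom of the diamond and pulled back along
   [p] to [l :: v]. *)
have [p [p0 [[hp hp0] e b b0]]] := diamondP ok ok0 ll0 lt lt0.
have [d1 h1 e1] := path_descent IH' hp0 b0 hd.
have eT : hact (p0 ++ l0 :: v) =1 hact (p ++ l :: v).
  have := hact_braid_eq v (be_sym e).
  by rewrite -!catA.
have [d2 h2 e2] := path_ascent IH' hp b (descent_eq eT h1).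
exists d2 => //; rewrite -!cats1.
apply: be_trans (be_catr [:: l] e2) _; rewrite -catA.
apply: be_trans (be_catl _ e) _; rewrite catA; exact: be_catr.
Qed.

(** The descent is built from [w] itself: each new letter changes the tuple by one move, and
    [step_ok_gen] follows that move whether it shortens or lengthens. *)
Lemma descent_exists w : all (letter_ok n) w -> exists2 d, descent w d & d ++ w ~~ [::].
Proof.
elim: w => [|l w IHw] /= => [_|/andP[ok hw]].
  by exists [::]; [apply: Descent0 | exact: be_refl].
have [d hd e] := IHw hw.
have [d' hd' e'] := step_ok_gen ok (unique_down w).2 (unique_down (l :: w)).2 hd.
exists d' => //; apply: be_trans e; rewrite -cat_rcons; exact: be_catr.
Qed.

Theorem hact_faithful u v : all (letter_ok n) u -> all (letter_ok n) v ->
  hact u =1 hact v -> u ~~ v.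
Proof.
move=> hu hv e; have [d1 h1 e1] := descent_exists hu.
have [d2 h2 e2] := descent_exists hv.
apply: (be_cancell (descent_ok h1)); apply: be_trans e1 (be_trans (be_sym e2) _).
by apply: be_catr; apply: (unique_down v).1 => //; exact: descent_eq h1.
Qed.
End Peak.

(** * From automorphisms of free groups to Hurwitz moves *)

Definition swap2 (T : Type) (Y : nat -> T) (k : nat) : T :=
  Y (swap_letter (k, false)).1.

Lemma swap2K (T : Type) (Y : nat -> T) : swap2 (swap2 Y) =1 Y.
Proof.
move=> k; rewrite /swap2 /swap_letter /=.
case: (eqVneq k 1%N) => [->|k1] //=.
by case: (eqVneq k 2) => [->|k2] //=; rewrite (negbTE k1) (negbTE k2).
Qed.

Section Eval.
Variable G : groupType.
Implicit Types (Y : nat -> G) (u v w : word).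

Definition sgn (x : G) (e : bool) : G := if e then x^-1 else x.

Definition ev Y w : G := foldr (fun l g => sgn (Y l.1) l.2 * g) 1 w.

Lemma sgnV x e : (sgn x e)^-1 = sgn x (~~ e).
Proof. by case: e; rewrite /= ?invgK. Qed.

Lemma sgnC x e : sgn x^-1 e = (sgn x e)^-1.
Proof. by case: e. Qed.

Lemma sgn_sgn x e e' : sgn (sgn x e) e' = sgn x (e (+) e').
Proof. by case: e e' => [] []; rewrite /= ?invgK. Qed.

Lemma sgnX x e n : sgn x e ^+ n = sgn (x ^+ n) e.
Proof. by case: e; rewrite //= expVgn. Qed.

Lemma sgn_inv x e : x * x = 1 -> sgn x e = x.
Proof. by case: e => //= /mulg1_eq. Qed.

Lemma conj_expg (x y : G) n : (x * y * x^-1) ^+ n = x * y ^+ n * x^-1.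
Proof.
elim: n => [|n IHn]; first by rewrite !expg0 mulg1 mulgV.
by rewrite !expgS IHn !mulgA mulgVK.
Qed.

Lemma sgn_conj (x y : G) e : sgn (x * y * x^-1) e = x * sgn y e * x^-1.
Proof. by case: e; rewrite //= !invgM invgK mulgA. Qed.

Lemma ev_eq Y Y' w : Y =1 Y' -> ev Y w = ev Y' w.
Proof. by move=> e; rewrite /ev; elim: w => //= l w ->; rewrite e. Qed.

Lemma ev_cat Y u v : ev Y (u ++ v) = ev Y u * ev Y v.
Proof. by elim: u => [|l u IHu] /=; rewrite ?mul1g // IHu mulgA. Qed.

Lemma ev1 Y l : ev Y [:: l] = sgn (Y l.1) l.2.
Proof. exact: mulg1. Qed.

Lemma ev_winv Y w : ev Y (winv w) = (ev Y w)^-1.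
Proof.
elim: w => [|l w IHw]; first by rewrite invg1.
by rewrite /winv /= rev_cons -cats1 ev_cat ev1 -/(winv w) IHw invgM sgnV.
Qed.

Lemma ev_rev Y w : ev Y (rev w) = (ev (fun k => (Y k)^-1) w)^-1.
Proof.
elim: w => [|l w IHw]; first by rewrite invg1.
by rewrite rev_cons -cats1 ev_cat ev1 IHw /= invgM sgnC invgK.
Qed.

Lemma ev_cons_red Y l w : ev Y (cons_red l w) = ev Y (l :: w).
Proof.
case: w => //= l' w; case: eqP => // -> /=.
by rewrite mulgA -sgnV mulgV mul1g.
Qed.

Lemma ev_red Y w : ev Y (red w) = ev Y w.
Proof. by elim: w => //= l w IHw; rewrite ev_cons_red /= IHw. Qed.

Lemma ev_subst Y f w : ev Y (subst f w) = ev (fun k => ev Y (f k)) w.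
Proof.
rewrite /subst ev_red; elim: w => //= -[k e] w IHw.
by rewrite ev_cat IHw; case: e => //=; rewrite ev_winv.
Qed.

Lemma ev_gen Y k : ev Y (gen k) = Y k.
Proof. exact: ev1. Qed.

Lemma ev_nseq Y k e r : ev Y (nseq r (k, e)) = sgn (Y k) e ^+ r.
Proof. by elim: r => // r IHr; rewrite expgS -IHr. Qed.

Lemma ev_swapw Y w :
  ev Y (swapw w) = ev (swap2 Y) w.
Proof. by elim: w => //= l w ->. Qed.
End Eval.

Definition upd2 (T : Type) (Y : nat -> T) (u v : T) (k : nat) : T :=
  if k == 1%N then u else if k == 2 then v else Y k.

Lemma ev_subst2 (G : groupType) (Y : nat -> G) W U V :
  ev Y (subst2 W U V) = ev (upd2 Y (ev Y U) (ev Y V)) W.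
Proof.
rewrite /subst2 ev_subst; apply: ev_eq => k; rewrite /fun2 /upd2.
by case: (k == 1%N) => //; case: (k == 2) => //; rewrite ev_gen.
Qed.

Lemma swapwK : involutive swapw.
Proof.
move=> w; rewrite /swapw -map_comp -[RHS]map_id; apply: eq_map => -[k e].
rewrite /swap_letter /=; case: (eqVneq k 1%N) => [->|k1] //=.
by case: (eqVneq k 2) => [->|k2] //=; rewrite (negbTE k1) (negbTE k2).
Qed.

Lemma ev_zgen (G : groupType) (Y : nat -> G) w : (forall k, Y k * Y k = 1) ->
  ev Y w = zhom Y (ev zgen w).
Proof.
move=> Y2; elim: w => //= -[k e] w ->.
by rewrite zhomM // !sgn_inv ?zhom_gen // zgen2.
Qed.

Definition hmove (e : bool) (T : groupType) (t : nat -> T) : nat -> T :=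
  hurwitz (lfst (1%N, e)) (lsnd (1%N, e)) t.

(* Substituting r-th roots of involutions for the letters and taking r-th powers
   of the images gives the Hurwitz move of sign e. *)
Definition hurwitz_step (G : groupType) (r : nat) (inc : zfree -> G)
    (e : bool) (A B : word) : Prop :=
  forall (Y : nat -> G) (t : nat -> zfree),
    (forall k, t k * t k = 1) -> (forall k, Y k ^+ r = inc (t k)) ->
    ev Y A ^+ r = inc (hmove e t 1%N) /\ ev Y B ^+ r = inc (hmove e t 2).

(** The closure rules run backwards along the symmetries, from a list entry to the given
    automorphisms. Inverse and Swap exchange the two signs, Backward keeps them. *)
Record step_invariant (G : groupType) (r : nat) (inc : zfree -> G)
    (P : bool -> word -> word -> Prop) : Prop := {
  si_red e A B : P e (red A) (red B) -> P e A B;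
  si_inv e A B A' B' : mutual_inverse2 A B A' B' -> P e A' B' -> P (~~ e) A B;
  si_swap e A B : P e (swapw B) (swapw A) -> P (~~ e) A B;
  si_rev e A B : P e (rev A) (rev B) -> P e A B;
  si_step e A B : P e A B -> hurwitz_step r inc e A B }.

Definition flip (m : bool) (l : letter) : letter := (l.1, l.2 (+) m).

Lemma flipK m w : map (flip m \o flip m) w = w.
Proof. by elim: w => //= -[i e] w ->; rewrite /flip /= addbK. Qed.

(** Both sides of the braid relation are palindromes, so inverting each letter is the same as
    inverting the word. *)
Lemma be_flip n m u v : braid_eq n u v -> braid_eq n (map (flip m) u) (map (flip m) v).
Proof.
elim=> {u v} [w|u v _|u v w _ IH1 _|u v p s _ IH|i e h1 h2|i j h1 h2 h3|i h1 h2].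
- exact: be_refl.
- exact: be_sym.
- exact: be_trans.
- by rewrite !map_cat; exact: be_ctx.
- by rewrite /flip /= addNb; exact: be_free.
- exact: be_comm_sign.
case: m => /=; last exact: be_braid.
apply: (@be_winv n [:: (i, false); (i.+1, false); (i, false)]
                   [:: (i.+1, false); (i, false); (i.+1, false)]).
- by rewrite /letter_ok /=; lia.
- by rewrite /letter_ok /=; lia.
- exact: be_braid.
Qed.

Lemma hact_out n w j : all (letter_ok n) w -> ~~ (1 <= j <= n)%N -> hact w j = zgen j.
Proof.
elim: w => //= l w IHw /andP[ok hw] hj; rewrite -(IHw hw hj) /hact /=.
have [_ h1 h2] := lfst_lsnd ok; rewrite hurwitz_oth //; lia.
Qed.

(** * Faithfulness from powers of generator images *)

Section Criterion.
Variables (G : groupType) (r : nat) (inc : zfree -> G) (X : nat -> G).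
Variable P : bool -> word -> word -> Prop.
Hypothesis inc_inj : injective inc.
Hypothesis Xr : forall k, X k ^+ r = inc (zgen k).
Hypothesis PI : step_invariant r inc P.

(** The power of the second image would be given by both z_1 and z_2 z_1 z_2. *)
Lemma si_excl A B : P true A B -> P false A B -> False.
Proof.
move=> /(si_step PI)/(_ X zgen zgen2 Xr)[_ e1].
move=> /(si_step PI)/(_ X zgen zgen2 Xr)[_]; rewrite e1.
by move=> /inc_inj/(congr1 val).
Qed.

Definition quad_step (q : quad) : Prop :=
  exists e, P e (qA q) (qB q) /\ P e (qC q) (qD q).

Lemma mutual_inverse2_sym A B A' B' :
  mutual_inverse2 A B A' B' -> mutual_inverse2 A' B' A B.
Proof. by case. Qed.

Lemma sym_step_quad q q' : sym_step q q' -> quad_step q' -> quad_step q.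
Proof.
case=> {q q'} [A B C D A' B' C' D' h1 h2 _ _ _ _|A B C D|A B C D] [e /= [p1 p2]].
- by exists (~~ e); split; [exact: (si_inv PI h1 p1) | exact: (si_inv PI h2 p2)].
- by exists (~~ e); split; apply: (si_swap PI).
- by exists e; split; apply: (si_rev PI).
Qed.

Lemma sym_equiv_quad q q' : sym_equiv q q' -> quad_step q' -> quad_step q.
Proof.
by elim=> {q q'} [q q' /sym_step_quad| |q1 q2 q3 _ IH1 _ IH2] // /IH2.
Qed.

Lemma theta_faithful n tau tauinv L : (3 <= n)%N -> local_rep n tau tauinv ->
  of_type n tau L -> (forall q, List.In q (entries L) -> quad_step q) ->
  faithful n tau tauinv.
Proof.
move=> n3 [inv _] typ entP.
have pairP i : (1 <= i)%N -> (i <= n - 2)%N -> exists e,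
    P e (tau i).1 (tau i).2 /\ P e (tau i.+1).1 (tau i.+1).2.
  move=> h1 h2; have [q /entP hq /sym_equiv_quad/(_ hq)[e [p1 p2]]] := typ i h1 h2.
  by exists e; split; apply: (si_red PI).
(* Consecutive quadruples share an automorphism, so all signs agree; if the common sign is [true],
   the mirror image of the braid acts. *)
have [m hm] : exists m, forall i, (1 <= i)%N -> (i < n)%N -> P m (tau i).1 (tau i).2.
  have [m [m1 _]] := pairP 1%N isT ltac:(lia).
  exists m; elim=> // i IH _ lt; case: (ltnP 0 i) => i0; last first.
    by have -> : i = 0%N by lia.
  have [m' [p1 p2]] := pairP i i0 ltac:(lia).
  have := IH i0 (ltnW lt); case: m m' p1 p2 {m1 IH} => [] [] // p1 p2 p3.
    by case: (si_excl p3 p1).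
  by case: (si_excl p1 p3).
have hinv i : (1 <= i)%N -> (i < n)%N -> P (~~ m) (tauinv i).1 (tauinv i).2.
  move=> h1 h2; apply: (si_inv PI (mutual_inverse2_sym (inv i h1 h2))); exact: hm.
pose mir := flip m.
have stepP l : letter_ok n l -> exists A B,
    hurwitz_step r inc (l.2 (+) m) A B /\
    forall j, gen_img tau tauinv l j = Tmap l.1 A B j.
  case: l => i [] /andP[/= h1 h2].
    exists (tauinv i).1, (tauinv i).2; split=> //.
    by apply: (si_step PI); exact: hinv.
  by exists (tau i).1, (tau i).2; split=> //; apply: (si_step PI); apply: hm.
have main w : all (letter_ok n) w -> forall j,
    ev X (theta tau tauinv w j) ^+ r = inc (hact (map mir w) j).
  elim: w => [_ j|l w IHw /= /andP[ok hw] j]; first by rewrite ev_gen Xr.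
  rewrite ev_subst; set Y := fun k => ev X (theta _ _ w k).
  set t := hact (map mir w); have Yt k : Y k ^+ r = inc (t k) by apply: IHw.
  have t2 k : t k * t k = 1 by apply: hact2.
  have [A [B [st ->]]] := stepP l ok.
  (* The rule for [A], [B] speaks of generators 1 and 2, so the values at [l.1] and [l.1.+1] are
     placed there. *)
  have [] := st (upd2 Y (Y l.1) (Y l.1.+1)) (upd2 t (t l.1) (t l.1.+1)).
  - by move=> k; rewrite /upd2; case: ifP => // _; case: ifP.
  - by move=> k; rewrite /upd2; case: ifP => // _; case: ifP.
  rewrite /Tmap.
  case: (eqVneq j l.1) => [->|j1] eA eB.
    rewrite ev_subst2 !ev_gen eA; congr inc.
    rewrite /hmove /mir /lfst /lsnd /hurwitz /upd2 /=.
    by case: (_ (+) _) => /=; rewrite ?eqxx // -[_ == _.+1]negbK neq_ltn ltnSn /= ?eqxx.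
  case: (eqVneq j l.1.+1) => [->|j2].
    rewrite ev_subst2 !ev_gen eB; congr inc.
    rewrite /hmove /mir /lfst /lsnd /hurwitz /upd2 /=.
    by case: (_ (+) _) => /=; rewrite ?eqxx // -[_.+1 == _]negbK neq_ltn ltnSn orbT /= ?eqxx.
  rewrite ev_gen Yt; congr inc; rewrite /hurwitz /lfst /lsnd /mir /=.
  by case: (_ (+) _); rewrite (negbTE j1) (negbTE j2).
move=> w1 w2 ok1 ok2 eqw.
have okm w : all (letter_ok n) (map mir w) = all (letter_ok n) w.
  by rewrite all_map; apply: eq_all.
suff: braid_eq n (map mir w1) (map mir w2).
  by move=> /(be_flip m); rewrite -!map_comp !flipK.
apply: hact_faithful; rewrite ?okm // => j.
(* The images are assumed equal only in this range; other positions are fixed by valid braids. *)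
case: (boolP (1 <= j <= n)%N) => jn; last by rewrite !(hact_out (n := n)) ?okm.
by apply: inc_inj; rewrite -!main // -!(ev_red _ (theta _ _ _ _)) eqw.
Qed.
End Criterion.

(** * Types C and D modulo squares *)

Lemma hmove_inv e (G : groupType) (t : nat -> G) :
  (forall k, t k * t k = 1) -> forall k, hmove e t k * hmove e t k = 1.
Proof. by move=> t2; apply: hurwitz_inv. Qed.

Lemma zhom_hmove e (t : nat -> zfree) k : (forall k, t k * t k = 1) ->
  zhom t (hmove e zgen k) = hmove e t k.
Proof.
move=> t2; rewrite /hmove /hurwitz (fun_if (zhom _)) (fun_if (zhom _)).
by rewrite !zhomM // !zhom_gen.
Qed.

(** Testing on the generators [zgen] suffices: evaluation at any involutions factors through the
    free product. *)
Definition zstep (e : bool) (A B : word) : Prop :=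
  ev zgen A = hmove e zgen 1%N /\ ev zgen B = hmove e zgen 2.

Lemma zstepP : step_invariant 1 id zstep.
Proof.
split=> e A B.
- by rewrite /zstep !ev_red.
- move=> A' B' [_ _ h1 h2] [e1 e2].
  have H W : ev (hmove e zgen) W = zhom (hmove e zgen) (ev zgen W).
    by apply: ev_zgen; apply: hmove_inv zgen2.
  have upd : upd2 zgen (ev zgen A') (ev zgen B') =1 hmove e zgen.
    move=> k; rewrite /upd2 e1 e2; case: eqP => [->|k1] //; case: eqP => [->|k2] //.
    by rewrite /hmove hurwitz_oth //; case: (e); rewrite /lfst /lsnd /=; lia.
  (* Moves of opposite sign are inverse on generators, hence everywhere; this solves the equations
     [h1], [h2] for the values of [A] and [B]. *)
  have K g : zhom (hmove (~~ e) zgen) (zhom (hmove e zgen) g) = g.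
    rewrite -[RHS]zhom_zgen; symmetry.
    apply: (zhom_morph (k := fun g => zhom (hmove (~~ e) zgen) (zhom (hmove e zgen) g))).
    - by rewrite !zhom1.
    - by move=> u v; rewrite !zhomM //; apply: hmove_inv zgen2.
    - move=> x; rewrite zhom_gen zhom_hmove; last exact: hmove_inv zgen2.
      rewrite /hmove /lfst /lsnd; by case: (e) => /=; apply: hurwitzK => //; exact: zgen2.
  have inv W k : ev zgen (subst2 W A' B') = zgen k -> ev zgen W = hmove (~~ e) zgen k.
    rewrite ev_subst2 (ev_eq _ upd) H => /(congr1 (zhom (hmove (~~ e) zgen))).
    by rewrite K zhom_gen.
  by split; apply: inv; rewrite ?h1 ?h2 ev_gen.
- have sw2 k : swap2 zgen k * swap2 zgen k = 1 by apply: zgen2.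
  have H W g : ev zgen (swapw W) = g -> ev zgen W = zhom (swap2 zgen) g.
    by move=> <-; rewrite -{1}(swapwK W) ev_swapw ev_zgen.
  by rewrite /zstep => -[/H -> /H ->]; split; case: (e); apply: val_inj.
- rewrite /zstep !ev_rev !(ev_eq _ zgenV) => -[h1 h2].
  by split; apply: invg_inj; rewrite ?h1 ?h2; symmetry; apply: mulg1_eq;
    apply: hmove_inv zgen2 _.
- move=> [h1 h2] Y t t2 Yt; rewrite !expg1.
  have Y2 k : Y k * Y k = 1 by have := Yt k; rewrite expg1 => ->.
  have eY : Y =1 t by move=> k; have := Yt k; rewrite expg1.
  rewrite (ev_eq A eY) (ev_eq B eY) (ev_zgen A t2) (ev_zgen B t2) h1 h2.
  by rewrite !(zhom_hmove _ _ t2).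
Qed.

(** * Roots of the generators *)

Section Wreath.
Variable s : nat.

Definition wreath : Type := ({ffun 'I_s.+1 -> zfree} * 'I_s.+1)%type.
HB.instance Definition _ := Choice.on wreath.
Implicit Types u v w : wreath.

Definition wmul u v : wreath :=
  ([ffun x : 'I_s.+1 => u.1 x * v.1 (x + u.2)%R], (u.2 + v.2)%R).
Definition wone : wreath := ([ffun=> 1], 0%R).
Definition winverse u : wreath := ([ffun x : 'I_s.+1 => (u.1 (x - u.2)%R)^-1], (- u.2)%R).

Lemma wmulA : associative wmul.
Proof.
move=> u v w; rewrite /wmul /= GRing.addrA; congr pair.
by apply/ffunP => x; rewrite !ffunE /= mulgA GRing.addrA.
Qed.

Lemma wmul1 : left_id wone wmul.
Proof.
case=> f k; rewrite /wmul /= GRing.add0r; congr pair.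
by apply/ffunP => x; rewrite !ffunE GRing.addr0 mul1g.
Qed.

Lemma wmulr1 : right_id wone wmul.
Proof.
case=> f k; rewrite /wmul /= GRing.addr0; congr pair.
by apply/ffunP => x; rewrite !ffunE mulg1.
Qed.

Lemma wmulV : left_inverse wone winverse wmul.
Proof.
case=> f k; rewrite /wmul /= GRing.addNr; congr pair.
by apply/ffunP => x; rewrite !ffunE mulVg.
Qed.

Lemma wmulrV : right_inverse wone winverse wmul.
Proof.
case=> f k; rewrite /wmul /= GRing.subrr; congr pair.
by apply/ffunP => x; rewrite !ffunE GRing.addrK mulgV.
Qed.

HB.instance Definition _ := isGroup.Build wreath wmulA wmul1 wmulr1 wmulV wmulrV.

Definition wdiag (g : zfree) : wreath := ([ffun=> g], 0%R).

Lemma wdiag_inj : injective wdiag.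
Proof. by move=> g h [/ffunP/(_ 0%R)]; rewrite !ffunE. Qed.

Lemma wdiagM g h : wdiag (g * h) = wdiag g * wdiag h.
Proof.
congr pair; last by rewrite GRing.addr0.
by apply/ffunP => x; rewrite !ffunE.
Qed.

(* A root of order s.+1 of the diagonal element z_k: rotate the coordinates and
   multiply by z_k once per turn. *)
Definition wroot (k : nat) : wreath :=
  ([ffun x : 'I_s.+1 => if x == s :> nat then zgen k else 1], inZp 1).

(** Within at most one full turn a coordinate passes position [s] at most once, exactly when
    [s < x + m]. *)
Lemma wrootX k m : (m <= s.+1)%N ->
  wroot k ^+ m = ([ffun x : 'I_s.+1 => if (s < x + m)%N then zgen k else 1], inZp m).
Proof.
elim: m => [_|m IHm le].
  rewrite expg0; congr pair; last exact: val_inj.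
  by apply/ffunP => x; rewrite !ffunE addn0 leqNgt ltn_ord.
rewrite expgS IHm; last exact: ltnW.
congr pair; last by apply: val_inj; rewrite /= modnDm add1n.
apply/ffunP => x; rewrite !ffunE /= modnDmr.
have := ltn_ord x; case: eqP => [->|xs] lt.
  rewrite addn1 modnn add0n; case: ltnP => [|_]; first lia.
  by case: ltnP => [|]; rewrite ?mulg1 //; lia.
rewrite mul1g modn_small; last by lia.
by rewrite addn1 addSnnS.
Qed.

Lemma wroot_order k : wroot k ^+ s.+1 = wdiag (zgen k).
Proof.
rewrite wrootX //; congr pair; last by apply: val_inj; rewrite /= modnn.
by apply/ffunP => x; rewrite !ffunE addnS ltnS leq_addl.
Qed.
End Wreath.

(** * Types A_r, C and D *)

(* Quantifying over all groups expresses an equality in the free group. *)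
Definition artin_form (r : nat) (A B : word) : Prop :=
  exists s eps del : bool, forall (G : groupType) (Y : nat -> G),
    ev Y A = (sgn (Y 1%N) s) ^+ r * sgn (Y 2) eps * ((sgn (Y 1%N) s) ^+ r)^-1 /\
    ev Y B = sgn (Y 1%N) del.

(** The opposite sign is encoded through Swap, so that most closure rules need only be proved for
    [artin_form]. *)
Definition artin_step (r : nat) (e : bool) (A B : word) : Prop :=
  if e then artin_form r (swapw B) (swapw A) else artin_form r A B.

Definition left_inverse2 (A B A' B' : word) : Prop :=
  forall (G : groupType) (Y : nat -> G),
    ev (upd2 Y (ev Y A) (ev Y B)) A' = Y 1%N /\
    ev (upd2 Y (ev Y A) (ev Y B)) B' = Y 2.

Lemma upd2_swap (G : groupType) (Y : nat -> G) u v :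
  swap2 (upd2 Y u v) =1 upd2 (swap2 Y) v u.
Proof.
move=> k; rewrite /swap2 /upd2 /swap_letter /=.
case: (eqVneq k 1%N) => [_|k1] //=.
by case: (eqVneq k 2) => [_|k2] //=; rewrite (negbTE k1) (negbTE k2).
Qed.

Lemma left_inverse2_swap A B A' B' : left_inverse2 A B A' B' ->
  left_inverse2 (swapw B) (swapw A) (swapw B') (swapw A').
Proof.
move=> h G Y; have [h1 h2] := h G (swap2 Y).
rewrite !ev_swapw !(ev_eq _ (upd2_swap _ _ _)).
by rewrite h1 h2.
Qed.

(** The defining equations are solved for the images [U], [V]: first [U] is a signed generator, then
    [V] is a conjugate by a power of it, of sign [~~ s (+) del]. *)
Lemma artin_form_inv r A B A' B' : left_inverse2 A B A' B' ->
  artin_form r A' B' -> artin_form r (swapw B) (swapw A).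
Proof.
move=> inv [s [eps [del h]]]; exists (~~ s (+) del), eps, del => G Y.
have [e1 e2] := inv G (swap2 Y); have [] := h G (upd2 (swap2 Y) (ev (swap2 Y) A) (ev (swap2 Y) B)).
rewrite e1 e2 !ev_swapw -[swap2 Y 1%N]/(Y 2) -[swap2 Y 2]/(Y 1%N).
rewrite /upd2 /=; move: (ev _ A) (ev _ B) => U V e3 e4.
have eU : U = sgn (Y 1%N) del by rewrite e4 sgn_sgn addbb.
split=> //; have -> : sgn (Y 1%N) (~~ s (+) del) = (sgn U s)^-1.
  by rewrite eU sgn_sgn sgnV; congr sgn; case: (s); case: (del).
rewrite e3 sgn_conj sgn_sgn addbb expVgn invgK.
by rewrite -!mulgA mulVg mulg1 mulKg.
Qed.

Lemma artin_step_red r e A B : artin_step r e (red A) (red B) -> artin_step r e A B.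
Proof.
case: e; case=> [s [eps [del h]]]; exists s, eps, del => G Y; have := h G Y;
  by rewrite ?ev_swapw !ev_red.
Qed.

Lemma artin_form_rev r A B : artin_form r (rev A) (rev B) -> artin_form r A B.
Proof.
case=> [s [eps [del h]]]; exists (~~ s), eps, del => G Y.
have := h G (fun k => (Y k)^-1); rewrite !ev_rev !(ev_eq _ (fun k => invgK (Y k))).
rewrite !sgnC => -[/(congr1 (@inv G)) + /(congr1 (@inv G))]; rewrite !invgK.
move=> -> ->; split=> //; rewrite !invgM !invgK.
by rewrite sgnV mulgA.
Qed.

Lemma artin_step_swap r e A B :
  artin_step r e (swapw B) (swapw A) -> artin_step r (~~ e) A B.
Proof. by case: e; rewrite /artin_step /= ?swapwK. Qed.

Lemma artin_stepP r : step_invariant r.+1 (@wdiag r) (artin_step r.+1).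
Proof.
split=> e A B.
- exact: artin_step_red.
- move=> A' B' [h1 h2 _ _].
  have inv : left_inverse2 A B A' B'.
    by move=> G Y; rewrite -!ev_subst2 h1 h2 !ev_gen.
  case: e => /=; last exact: artin_form_inv.
  by move/(artin_form_inv (left_inverse2_swap inv)); rewrite !swapwK.
- exact: artin_step_swap.
- case: e; last exact: artin_form_rev.
  by rewrite /artin_step /swapw !map_rev; exact: artin_form_rev.
- have H C D (Y : nat -> wreath r) (t : nat -> zfree) : artin_form r.+1 C D ->
      (forall k, t k * t k = 1) -> (forall k, Y k ^+ r.+1 = wdiag r (t k)) ->
      ev Y C ^+ r.+1 = wdiag r (t 1%N * t 2 * t 1%N) /\ ev Y D ^+ r.+1 = wdiag r (t 1%N).
    move=> [s [eps [del h]]] t2 Yt; have [-> ->] := h _ Y.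
    have d2 k : wdiag r (t k) * wdiag r (t k) = 1 by rewrite -wdiagM t2.
    (* Powers pass inside the conjugation, and there every base is an involution, so all signs
       disappear. *)
    rewrite conj_expg !sgnX !Yt !sgn_inv ?wdiagM //; split=> //.
    by rewrite (mulg1_eq (d2 1%N)).
  move=> hAB Y t t2 Yt; rewrite /hmove; case: e hAB => hAB.
    have := H _ _ (swap2 Y) (swap2 t) hAB (fun k => t2 _) (fun k => Yt _).
    rewrite !ev_swapw !(ev_eq _ (swap2K Y)) => -[-> ->].
    by [].
  exact: H hAB t2 Yt.
Qed.

Lemma entries_artin r q : List.In q (entries (LA r)) ->
  quad_step (artin_step r) q.
Proof.
have F (s eps del : bool) (A B : word) :
    A = nseq r (1%N, s) ++ [:: (2, eps)] ++ nseq r (1%N, ~~ s) ->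
    B = [:: (1%N, del)] -> artin_form r A B.
  move=> -> ->; exists s, eps, del => G Y.
  by rewrite !ev_cat !ev1 !ev_nseq -sgnV expVgn mulgA.
move=> hq; exists false; move: hq => /=.
case=> [<-|[<-|[<-|]]] //=; split.
- exact: (F false false false).
- exact: (F false false false).
- exact: (F false false false).
- exact: (F false true true).
- exact: (F false true true).
- exact: (F true true true).
Qed.

Lemma entries_zstep L q : (if L is LA _ then false else true) ->
  List.In q (entries L) -> quad_step zstep q.
Proof.
by case: L => //= _ hq; exists false; move: hq;
  do ![case=> [<-|]] => //; split; split; apply: val_inj.
Qed.

Local Close Scope group_scope.

Theorem theorem2p2 (n : nat) (tau tauinv : nat -> word * word) (L : label) :
  3 <= n ->
  local_rep n tau tauinv ->
  (match L with LA r => 1 <= r | LC => true | LD => true end) ->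
  of_type n tau L ->
  faithful n tau tauinv.
Proof.
move=> n3 rep hL typ.
have Z : (if L is LA _ then false else true) -> faithful n tau tauinv.
  (* Types C and D use first powers: the generators themselves are evaluated at involutions. *)
  move=> hL'; have Xr k : (zgen k ^+ 1)%g = id (zgen k) by rewrite expg1.
  apply: (theta_faithful (@inj_id zfree) Xr zstepP n3 rep typ) => q.
  exact: entries_zstep.
(* The bound on [r] leaves positive exponents [r.+1], for which the wreath product over ['I_r.+1]
   has the required roots. *)
case: L hL typ Z => [[|r] // _ typ _|_ _ Z|_ _ Z]; [|exact: Z|exact: Z].
apply: (theta_faithful (@wdiag_inj r) (@wroot_order r) (artin_stepP r) n3 rep typ).
exact: entries_artin.
Qed.
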